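(* For each quarter-convex disk $K\subset\mathbb{R}^2$, the translative covering density and the lattice covering density of $K$ coincide: $$\vartheta_T(K)=\vartheta_L(K).$$
   Context: A convex disk is a compact convex subset of $\mathbb{R}^2$ with nonempty interior. $|S|$ denotes the area (Lebesgue measure) of $S$. Quarter-convex disks: let $f:[0,1]\to\mathbb{R}$ be a concave, non-increasing, continuous function with $f(0)=1$ and $f(1)\ge 0$, and put $K_f=\{(x,y): 0\le x\le 1,\ 0\le y\le f(x)\}$. A convex disk $K$ is a quarter-convex disk if $K$ is affinely equivalent to $K_f$ for some such $f$. Densities: for a family $\mathcal{F}=\{K_1,K_2,\dots\}$ of convex disks and a bounded domain $D$, let $d_-(\mathcal{F},D)=\frac{1}{|D|}\sum_{K\in\mathcal{F},\,K\subset D}|K|$, and let $d_-(\mathcal{F})=\liminf_{r\to\infty} d_-(\mathcal{F},rB^2)$, where $B^2$ is the unit disk centered at the origin. For a convex disk $K$ and a discrete set $X\subset\mathbb{R}^2$, $K+X$ denotes the family $\{K+x\}_{x\in X}$; it is a translative covering with $K$ if $\bigcup_{x\in X}(K+x)=\mathbb{R}^2$, and a lattice covering if moreover $X$ is a lattice. Define $\vartheta_T(K)=\inf d_-(\mathcal{F})$, the infimum over all translative coverings $\mathcal{F}$ with $K$, and $\vartheta_L(K)=\inf d_-(\mathcal{F})$, the infimum over all lattice coverings $\mathcal{F}$ with $K$. *)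

(* Defs.v *)
From HB Require Import structures.
From mathcomp Require Import all_boot all_order all_algebra.
From mathcomp Require Import all_classical all_reals all_analysis.

Set Implicit Arguments.
Unset Strict Implicit.
Unset Printing Implicit Defensive.

Import Order.TTheory GRing.Theory Num.Theory.
Import numFieldNormedType.Exports.

Local Open Scope classical_set_scope.
Local Open Scope ring_scope.

(* [R^o] rather than [R] so that the product carries the R-vector space
   structure; its topology and Borel sigma-algebra are the usual ones. *)
Notation plane R := (R^o * R^o)%type.

Section ConvexDisks.
Variable R : realType.
Implicit Types (K L : set (plane R)) (f : R -> R).

Definition area K : \bar R :=
  ((@lebesgue_measure R) \x (@lebesgue_measure R))%E K.

Definition convex_disk K : Prop :=
  [/\ compact K, convex_set K & K° !=set0].

Definition concave_on (D : set R) f : Prop :=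
  forall x y t : R, D x -> D y -> 0 <= t <= 1 ->
    t * f x + (1 - t) * f y <= f (t * x + (1 - t) * y).

Definition quarter_profile f : Prop :=
  [/\ concave_on `[0, 1] f,
      {in `[0, 1] &, {homo f : x y /~ x <= y}},
      {within `[0, 1], continuous f},
      f 0 = 1
    & 0 <= f 1].

Definition subgraph f : set (plane R) :=
  [set p | 0 <= p.1 <= 1 /\ 0 <= p.2 <= f p.1].

Definition affinely_equivalent K L : Prop :=
  exists (A : {linear plane R -> plane R}) (b : plane R),
    bijective A /\ K = [set A p + b | p in L].

Definition quarter_convex_disk K : Prop :=
  convex_disk K /\
  exists f, quarter_profile f /\ affinely_equivalent K (subgraph f).

End ConvexDisks.

Section Densities.
Variable R : realType.
Implicit Types (K D : set (plane R)) (X : set (plane R)).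

(* The norm of the library on a product is the sup norm, hence the explicit
   Euclidean formula. *)
Definition euclidean_disk (r : R) : set (plane R) :=
  [set p | p.1 ^+ 2 + p.2 ^+ 2 <= r ^+ 2].

Definition lower_density_in (I : choiceType) (S : set I)
    (F : I -> set (plane R)) D : \bar R :=
  ((\esum_(i in [set i | S i /\ F i `<=` D]) area (F i)) / area D)%E.

Definition lower_density (I : choiceType) (S : set I)
    (F : I -> set (plane R)) : \bar R :=
  limf_einf (fun r : R => lower_density_in S F (euclidean_disk r))
    (pinfty_nbhs R).

Definition translate K (x : plane R) : set (plane R) := [set p + x | p in K].

Definition discrete_set X : Prop := X `<=` isolated X.

Definition is_lattice X : Prop :=
  exists u v : plane R,
    (forall a b : R, a *: u + b *: v = 0 -> a = 0 /\ b = 0) /\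
    X = [set u *~ m + v *~ n | m in [set: int] & n in [set: int]].

Definition translative_covering K X : Prop :=
  discrete_set X /\ \bigcup_(x in X) translate K x = [set: plane R].

Definition lattice_covering K X : Prop :=
  translative_covering K X /\ is_lattice X.

Definition theta_T K : \bar R :=
  ereal_inf [set lower_density X (translate K) | X in translative_covering K].

Definition theta_L K : \bar R :=
  ereal_inf [set lower_density X (translate K) | X in lattice_covering K].

End Densities.

(* Main.v *)
Require Import Defs.
From HB Require Import structures.
From mathcomp Require Import all_boot all_order all_algebra.
From mathcomp Require Import all_classical all_reals all_analysis.
From mathcomp Require Import measurable_realfun lra ring.

(* Let K be an affine image of K_f and mu the pull-back of the area to the
   coordinates of K_f.  For a, b in [0, 1] the L-shape R(a) u R(b), where R(s) is
   the rectangle [0, s] x [0, f s], lies in K_f and is the fundamental tile of a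
   lattice; so theta_L K <= |K| / mu(L-shape).

   Conversely, in a translative covering each point q is given to the translate
   y + K_f with y <= q whose roof is highest above q.  The part given to y lies
   in y + (R(s_0) u ... u R(s_k)), where one s_i is the right end of that part and
   each of the others is caused by another translate z, and every z causes at most
   one corner overall: on average there are at most two rectangles per translate.
   As R(a) and R(b) meet inside R(c) for every c between a and b, an exchange
   argument shows that the largest mu-area of a union of n rectangles is
   bounded by the line through its values at n = 1 and n = 2.  So N
   translates cover at most N times the largest area of an L-shape, and the
   covering is no thinner than the best lattice one. *)

Set Implicit Arguments.
Unset Strict Implicit.
Unset Printing Implicit Defensive.

Import Order.TTheory GRing.Theory Num.Theory.
Import numFieldNormedType.Exports.

Local Open Scope classical_set_scope.
Local Open Scope ring_scope.

Notation mplane R := (measurableTypeR R * measurableTypeR R)%type.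

(** * Area in the plane: dilations, translations, boxes and disks *)

Section Area.
Variable R : realType.
Implicit Types (S : set (mplane R)) (p : mplane R).

Definition area_measure : {measure set (mplane R) -> \bar R} :=
  ((@lebesgue_measure R) \x (@lebesgue_measure R))%E.

Lemma measurable_scale_shift (c t : R) :
  measurable_fun [set: measurableTypeR R] (fun x : measurableTypeR R => c * x + t : measurableTypeR R).
Proof. by apply: measurable_funD => //; apply: measurable_funM. Qed.

Lemma measurable_affine (a b c a' b' c' : R) :
  measurable_fun [set: mplane R]
    (fun p : mplane R => (a * p.1 + b * p.2 + c, a' * p.1 + b' * p.2 + c') : mplane R).
Proof.
have mf x y z : measurable_fun [set: mplane R]
    (fun p : mplane R => x * p.1 + y * p.2 + z : measurableTypeR R).
  apply: measurable_funD => //; apply: measurable_funD; apply: measurable_funM => //.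
exact: (measurable_fun_pair (mf _ _ _) (mf _ _ _)).
Qed.

(** By uniqueness of Lebesgue measure: the right side, as a function of [A], is a measure with the
    correct value on half-open intervals. *)
Lemma lebesgue_scale_shift (c t : R) (A : set (measurableTypeR R)) : 0 < c -> measurable A ->
  lebesgue_measure A = (c%:E * lebesgue_measure ((fun x => (c * x + t)%R) @^-1` A))%E.
Proof.
move=> c0 mA.
have c0' : 0 <= c by exact: ltW.
pose g : measurableTypeR R -> measurableTypeR R := fun x => c * x + t.
have mg : measurable_fun setT g by exact: measurable_scale_shift.
pose m : {measure set (measurableTypeR R) -> \bar R} :=
  mscale (NngNum c0') (pushforward (@lebesgue_measure R) g).
rewrite (@lebesgue_measure_unique _ (m mg)) //= => _ [[a b]] _ <-.
rewrite /m /mscale /= /pushforward.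
have -> : g @^-1` `]a, b]%classic = `](a - t) / c, (b - t) / c]%classic.
  apply/seteqP; split => x /=; rewrite !in_itv /= /g;
  rewrite ltr_pdivrMr // ler_pdivlMr // => /andP[? ?]; apply/andP; split; lra.
rewrite !lebesgue_measure_itv /= !lte_fin.
rewrite ltr_pM2r ?invr_gt0 // ltrBlDr subrK.
case: ifP => _; last by rewrite mule0.
rewrite -!EFinB -EFinM; congr EFin; field; exact: lt0r_neq0.
Qed.

Definition dilate (c : R) (v p : R * R) : R * R := (c * p.1 + v.1, c * p.2 + v.2).

Lemma measurable_dilate (c : R) (v : R * R) :
  measurable_fun [set: mplane R] (dilate c v : mplane R -> mplane R).
Proof.
have := measurable_affine c 0 v.1 0 c v.2.
by apply: eq_measurable_fun => p _; rewrite /dilate !mul0r add0r addr0.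
Qed.

(** The right side is a measure agreeing with the area on products. The case [c = 1] is translation
    invariance; the case [v = (0, 0)] gives the quadratic growth of disks. *)
Lemma area_scale_shift (c : R) (v : R * R) S : 0 < c -> measurable S ->
  area S = ((c ^+ 2)%:E * area (dilate c v @^-1` S))%E.
Proof.
move=> c0 mS.
have c20 : 0 <= c ^+ 2 by rewrite exprn_ge0 // ltW.
pose g : mplane R -> mplane R := dilate c v.
have mg : measurable_fun setT g by exact: measurable_dilate.
pose m : {measure set (mplane R) -> \bar R} :=
  mscale (NngNum c20) (pushforward area_measure g).
rewrite /area (@product_measure_unique _ _ _ _ _ _ _ (m mg)) //= => A B mA mB.
rewrite /m /mscale /= /pushforward.
have -> : g @^-1` (A `*` B) =
   ((fun x => c * x + v.1) @^-1` A) `*` ((fun x => c * x + v.2) @^-1` B) by [].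
have mpre t D : measurable D ->
    measurable ((fun x : measurableTypeR R => c * x + t : measurableTypeR R) @^-1` D).
  by move=> mD; rewrite -[X in measurable X]setTI; exact: measurable_scale_shift.
rewrite product_measure1E ?(lebesgue_scale_shift v.1 c0 mA) ?(lebesgue_scale_shift v.2 c0 mB);
  try exact: mpre.
by rewrite expr2 EFinM muleACA.
Qed.

Lemma translateE (K : set (plane R)) (v : plane R) :
  translate K v = dilate 1 (- v) @^-1` K.
Proof.
apply/seteqP; split => [_ [p Kp <-]|p /= Kp].
  by rewrite /= /dilate !mul1r !addrK; case: p Kp.
by exists (p - v); [move: Kp; rewrite /dilate !mul1r | rewrite subrK].
Qed.

Lemma measurable_translate (K : set (mplane R)) (v : plane R) :
  measurable K -> measurable (translate K v : set (mplane R)).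
Proof.
move=> mK; rewrite translateE -[X in measurable X]setTI.
exact: measurable_dilate.
Qed.

Lemma area_translate (K : set (mplane R)) (v : plane R) :
  measurable K -> area (translate K v) = area K.
Proof.
by move=> mK; rewrite translateE [RHS](area_scale_shift (- v) ltr01 mK) expr1n mul1e.
Qed.

Lemma area_box (a b c d : R) : a <= b -> c <= d ->
  area (`[a, b] `*` `[c, d]) = ((b - a) * (d - c))%:E.
Proof.
move=> ab cd; rewrite /area product_measure1E //.
have E (x y : R) : x <= y -> lebesgue_measure `[x, y] = (y - x)%:E.
  rewrite lebesgue_measure_itv /= lte_fin le_eqVlt => /orP[/eqP ->|->] //.
  by rewrite ltxx subrr.
by rewrite [X in (X * _)%E]E // [X in (_ * X)%E]E // EFinM.
Qed.

Lemma le_area (S T : set (mplane R)) : measurable S -> measurable T -> S `<=` T ->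
  (area S <= area T)%E.
Proof. by move=> mS mT; apply: (le_measure area_measure); rewrite inE. Qed.

Lemma measurable_disk (r : R) : measurable (euclidean_disk r : set (mplane R)).
Proof.
rewrite (_ : euclidean_disk r =
  (fun p : mplane R => p.1 ^+ 2 + p.2 ^+ 2) @^-1` `]-oo, r ^+ 2]); last first.
  by apply/seteqP; split=> p; rewrite /= in_itv.
rewrite -[X in measurable X]setTI.
have mf : measurable_fun [set: mplane R] (fun p : mplane R => p.1 ^+ 2 + p.2 ^+ 2 : measurableTypeR R).
  by apply: measurable_funD; apply: measurable_funX.
exact: mf.
Qed.

Lemma area_disk_scale (r : R) : 0 < r ->
  area (euclidean_disk r) = ((r ^+ 2)%:E * area (euclidean_disk (1 : R)))%E.
Proof.
move=> r0; rewrite (area_scale_shift (0, 0) r0 (measurable_disk r)).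
congr (_ * area _)%E; apply/seteqP; rewrite /euclidean_disk.
have r2 : 0 < r ^+ 2 by rewrite exprn_gt0.
by split=> p /=; rewrite /dilate /= !addr0 !exprMn -mulrDr expr1n -{2}[r ^+ 2]mulr1 ler_pM2l.
Qed.

Lemma area_disk_gt0 (r : R) : 0 < r -> (0 < area (euclidean_disk r))%E.
Proof.
move=> r0; apply: (@lt_le_trans _ _ (area (`[0, r / 2] `*` `[0, r / 2]))).
  by rewrite area_box ?lte_fin ?subr0; try lra; apply: mulr_gt0; lra.
apply: le_area; [exact: measurableX | exact: measurable_disk |].
move=> [x y] [] /=; rewrite !in_itv /= => /andP[? ?] /andP[? ?]; rewrite /euclidean_disk /=; nra.
Qed.

Lemma norm_le_of_sqr (r z : R) : z ^+ 2 <= r ^+ 2 -> `|z| <= `|r|.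
Proof. by move=> zr; rewrite -ler_sqr ?nnegrE // !real_normK ?num_real. Qed.

Lemma area_disk_fin (r : R) : (area (euclidean_disk r) < +oo)%E.
Proof.
apply: (@le_lt_trans _ _ (area (`[- `|r|, `|r|] `*` `[- `|r|, `|r|]))).
  apply: le_area; [exact: measurable_disk | exact: measurableX |].
  move=> [x y]; rewrite /euclidean_disk /= !in_itv /= => H.
  rewrite -!ler_norml; split; apply: norm_le_of_sqr; apply: (le_trans _ H).
    by rewrite lerDl sqr_ge0.
  by rewrite lerDr sqr_ge0.
by rewrite area_box ?ltry //; have := normr_ge0 r; lra.
Qed.

Lemma area_interior_gt0 (K : set (mplane R)) : measurable K -> (K : set (plane R))° !=set0 ->
  (0 < area K)%E.
Proof.
move=> mK [[x y]] /nbhs_ballP [e /= e0 eK].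
apply: (@lt_le_trans _ _ (area (`[x - e / 2, x + e / 2] `*` `[y - e / 2, y + e / 2]))).
  by rewrite area_box ?lte_fin; try lra; apply: mulr_gt0; lra.
apply: le_area => //; first exact: measurableX.
move=> [a b] [] /=; rewrite !in_itv /= => /andP[? ?] /andP[? ?]; apply: eK.
by split => /=; rewrite /ball /= ltr_norml; apply/andP; split; lra.
Qed.

End Area.

(** * Concave profiles *)

Section Profile.
Variables (R : realType) (f : R -> R).
Hypothesis hf : quarter_profile f.

Lemma profile_mono (x y : R) : 0 <= x -> x <= y -> y <= 1 -> f y <= f x.
Proof.
case: hf => _ mono _ _ _ x0 xy y1.
by apply: mono => //; rewrite in_itv /=; apply/andP; split; lra.
Qed.

Lemma profile_le1 (x : R) : 0 <= x -> x <= 1 -> f x <= 1.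
Proof. by move=> x0 x1; case: (hf) => _ _ _ <- _; exact: profile_mono. Qed.

Lemma profile_ge0 (x : R) : 0 <= x -> x <= 1 -> 0 <= f x.
Proof.
by move=> x0 x1; case: (hf) => _ _ _ _ f1; apply: (le_trans f1); exact: profile_mono.
Qed.

(** The points [u + d] and [v] are convex combinations of [u] and [v + d] with the weights [t] and
    [1 - t] exchanged; adding the two concavity inequalities makes the weights disappear. *)
Lemma profile_drop (u v d : R) : 0 <= d -> 0 <= u -> u <= v -> v + d <= 1 ->
  f u - f (u + d) <= f v - f (v + d).
Proof.
case: hf => conc _ _ _ _ d0 u0 uv vd1.
have [E|nz] := eqVneq (v + d - u) 0.
  by have <- : u = v by lra.
have Lgt0 : 0 < v + d - u by rewrite lt_def nz /=; lra.
pose t := d / (v + d - u).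
have tL : t * (v + d - u) = d by rewrite /t divfK.
have t0 : 0 <= t by rewrite /t divr_ge0 // ltW.
have t1 : t <= 1 by rewrite /t ler_pdivrMr // mul1r; lra.
have Du : `[0, 1]%classic u by rewrite /= in_itv /=; apply/andP; split; lra.
have Dv : `[0, 1]%classic (v + d) by rewrite /= in_itv /=; apply/andP; split; lra.
have := conc u (v + d) t Du Dv; rewrite t0 t1 => /(_ isT).
have := conc (v + d) u t Dv Du; rewrite t0 t1 => /(_ isT).
have -> : t * (v + d) + (1 - t) * u = u + d.
  by rewrite -[in RHS]tL; ring.
have -> : t * u + (1 - t) * (v + d) = v.
  have -> : t * u + (1 - t) * (v + d) = v + d - t * (v + d - u) by ring.
  by rewrite tL; ring.
nra.
Qed.

(** Intermediate value theorem at the value halfway between [f b] and [c]. It serves as left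
    continuity at [b]: the strict inequality persists strictly to the left of [b]. *)
Lemma profile_left_cont (a b c : R) : 0 <= a -> a < b -> b <= 1 ->
  f b < c -> c <= f a -> exists2 s, a < s < b & f s < c.
Proof.
move=> a0 ab b1 fbc cfa; case: hf => _ _ cont _ _.
pose m := (f b + c) / 2.
have cab : {within `[a, b], continuous f}.
  apply: continuous_subspaceW cont; apply: subset_itv; rewrite bnd_simp //.
have [|s] := IVT (v := m) (ltW ab) cab.
  by rewrite /m ge_min le_max; apply/andP; split; apply/orP; [right|left]; lra.
rewrite in_itv /= => /andP[as_ sb] fs.
exists s; last by rewrite fs /m; lra.
rewrite !lt_neqAle as_ sb !andbT; apply/andP; split; apply/eqP => E.
  by move: fs; rewrite -E /m; lra.
by move: fs; rewrite E /m; lra.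
Qed.

End Profile.

(** * Ownership of points in a finite family of translates *)

Lemma exists_seq_max (T : eqType) (d : Order.disp_t) (O : orderType d) (k : T -> O)
    (s : seq T) : s != [::] -> exists2 m, m \in s & {in s, forall y, (k y <= k m)%O}.
Proof.
elim: s => // x s IH _; case: (eqVneq s [::]) => [->|/IH[m ms mP]].
  by exists x; rewrite ?mem_head // => y; rewrite inE => /eqP ->.
have [h|h] := leP (k x) (k m).
  exists m; first by rewrite inE ms orbT.
  by move=> y; rewrite inE => /orP[/eqP ->|/mP].
exists x; first by rewrite mem_head.
by move=> y; rewrite inE => /orP[/eqP ->|/mP ym] //; exact: (le_trans ym (ltW h)).
Qed.

Section Staircase.
Variables (R : realType) (f : R -> R).
Hypothesis hf : quarter_profile f.
Local Notation pt := (R * R)%type.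

Definition height (y : pt) (s : R) : R := y.2 + f (s - y.1).

Definition over (y : pt) (s : R) : bool := (y.1 <= s) && (s <= y.1 + 1).

(* The translates standing over the same vertical line are ranked by the height
   of their roof; the ties are broken so that the proof needs no general
   position assumption. *)
Definition rank (s : R) (y : pt) : (R *l (R *l R))%type :=
  (height y s, ((y.2, - y.1) : (R *l R)%type)).

Lemma le_rank (s : R) (w y : pt) : (rank s w <= rank s y)%O =
  (height w s <= height y s) &&
  ((height y s <= height w s) ==> ((w.2 <= y.2) && ((y.2 <= w.2) ==> (- w.1 <= - y.1)))).
Proof. by rewrite /rank !leEprodlexi. Qed.

Lemma rank_inj (s : R) (w y : pt) : rank s w = rank s y -> w = y.
Proof. by case: w y => [a b] [c d] [] _ -> /oppr_inj ->. Qed.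

(** This is [profile_drop] with the horizontal offset [y.1 - w.1] as [d]. Hence the roof starting
    further right, once above the other, stays above it as long as both stand over the line. *)
Lemma height_leftward (w y : pt) (s t : R) : w.1 <= y.1 -> s <= t ->
  over w s -> over w t -> over y s -> over y t ->
  height y s - height w s <= height y t - height w t.
Proof.
rewrite /over /height => wy st /andP[? ?] /andP[? ?] /andP[? ?] /andP[? ?].
have := @profile_drop _ f hf (s - y.1) (t - y.1) (y.1 - w.1).
have -> : s - y.1 + (y.1 - w.1) = s - w.1 by ring.
have -> : t - y.1 + (y.1 - w.1) = t - w.1 by ring.
move=> H; have := H ltac:(lra) ltac:(lra) ltac:(lra) ltac:(lra); lra.
Qed.

Lemma height_le (w y : pt) (s : R) : w.1 <= y.1 -> w.2 <= y.2 ->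
  over w s -> over y s -> height w s <= height y s.
Proof.
rewrite /over /height => ? ? /andP[? ?] /andP[? ?].
have := @profile_mono _ f hf (s - y.1) (s - w.1) ltac:(lra) ltac:(lra) ltac:(lra).
lra.
Qed.

Variable S : seq pt.

Definition below (q y : pt) : bool := over y q.1 && (y.2 <= q.2).

Definition covers (y q : pt) : bool := below q y && (q.2 <= height y q.1).

(** The point [q] may lie above the roof of its owner; but if any translate covers [q], then so does
    the owner, whose roof is the highest ([owner_exists]). *)
Definition owner (y q : pt) : Prop :=
  [/\ y \in S, below q y &
      {in S, forall w, below q w -> (rank q.1 w <= rank q.1 y)%O}].

(* [y] owns the points just to the left of [z], so [z] cuts a corner out of the
   part of the plane owned by [y]. *)
Definition parent (y z : pt) : bool :=
  let cand w := [&& w.1 < z.1, z.1 <= w.1 + 1 & w.2 <= z.2] in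
  cand y && all (fun w => cand w ==> (rank z.1 w <= rank z.1 y)%O) S.

Lemma owner_exists (y q : pt) : y \in S -> covers y q ->
  exists2 o, owner o q & covers o q.
Proof.
move=> yS /andP[yq qh].
have yF : y \in [seq w <- S | below q w] by rewrite mem_filter yq.
have [|o] := @exists_seq_max _ _ _ (rank q.1) [seq w <- S | below q w].
  by case: [seq w <- S | below q w] yF.
rewrite mem_filter => /andP[oq oS] oP.
exists o; first by split => // w wS wq; apply: oP; rewrite mem_filter wq.
rewrite /covers oq /= (le_trans qh) //.
by have := oP y yF; rewrite le_rank => /andP[].
Qed.

Lemma parent_inj (y y' z : pt) : y \in S -> y' \in S -> parent y z -> parent y' z -> y = y'.
Proof.
move=> yS y'S /andP[c /allP a] /andP[c' /allP a'].
apply: (@rank_inj z.1); apply/le_anti.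
by rewrite (implyP (a' _ yS) c) (implyP (a _ y'S) c').
Qed.

(* Right of this abscissa the column above [y] is taken over by a translate
   starting no higher than [y]. *)
Definition dominated (y : pt) : set R :=
  [set s | over y s /\ exists w, [/\ w \in S, w.2 <= y.2, over w s & height y s < height w s]].

(** Adjoining [y.1 + 1] keeps the set nonempty, so that [inf] is a genuine infimum, and gives the
    full width when nothing dominates [y]. *)
Definition reach (y : pt) : R := inf (dominated y `|` [set y.1 + 1]).

Lemma reach_bound (y : pt) : y.1 <= reach y <= y.1 + 1.
Proof.
have lb : lbound (dominated y `|` [set y.1 + 1]) y.1.
  by move=> s [[/andP[]]//|->]; lra.
apply/andP; split.
  by apply: lb_le_inf lb; exists (y.1 + 1); right.
by apply: ge_inf; [exists y.1 | right].
Qed.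

Lemma reach_lt (y : pt) (s : R) : s < reach y -> ~ dominated y s.
Proof.
move=> sr Ds; have : reach y <= s; last by lra.
apply: ge_inf; last by left.
by exists y.1 => t [[/andP[]]//|->]; lra.
Qed.

(** A dominating [w] starts to the right of [y], for otherwise [height_le] would keep its roof at or
    below that of [y]; [height_leftward] then preserves the domination up to the end of the column
    of [y]. *)
Lemma dominated_right (y : pt) (s t : R) : dominated y s -> s <= t -> t <= y.1 + 1 ->
  exists w, [/\ w \in S, w.2 <= y.2, over w t, over w s & height y t < height w t].
Proof.
move=> [ys [w [wS wy ws hs]]] st ty.
have wy1 : y.1 < w.1.
  rewrite ltNge; apply/negP => wy1.
  by have := height_le wy1 wy ws ys; lra.
have yt : over y t by case/andP: ys => *; apply/andP; split; lra.
have wt : over w t by case/andP: ws => *; apply/andP; split; lra.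
exists w; split => //.
by have := height_leftward (ltW wy1) st ys yt ws wt; lra.
Qed.

Lemma owner_reach (y q : pt) : owner y q -> q.1 <= reach y.
Proof.
move=> [yS /andP[/andP[yq yq'] yq2] yP].
apply: lb_le_inf; first by exists (y.1 + 1); right.
move=> s [Ds|->//]; rewrite leNgt; apply/negP => sq.
have [w [wS wy wq _ hq]] := dominated_right Ds (ltW sq) yq'.
have := yP w wS; rewrite /below wq (le_trans wy yq2) => /(_ isT).
by rewrite le_rank => /andP[]; lra.
Qed.

(** Right ends, relative to [y], of the rectangles that contain the covered points owned by [y], as
    [exists_corner] shows when the unit square at [y] is covered. *)
Definition widths (y : pt) : seq R :=
  (reach y - y.1) :: [seq z.1 - y.1 | z <- S & parent y z].

Lemma widths01 (y : pt) : {in widths y, forall s, 0 <= s <= 1}.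
Proof.
move=> s; rewrite inE => /orP[/eqP ->|/mapP[z]].
  by have := reach_bound y; lra.
by rewrite mem_filter => /andP[/andP[/and3P[? ? _] _] _] ->; lra.
Qed.

(** Exchanging the sums counts the parents of each [z], and [parent_inj] allows at most one. *)
Lemma sum_parents : uniq S ->
  (\sum_(y <- S) size [seq z <- S | parent y z] <= size S)%N.
Proof.
move=> uS; under eq_bigr do rewrite size_filter -sum1_count big_mkcond.
rewrite exchange_big /= -sum1_size big_seq [leqRHS]big_seq.
apply: leq_sum => z zS.
have [/hasP[y yS yz]|/hasPn no] := boolP (has (parent^~ z) S).
  rewrite (bigD1_seq y) //= yz big1_seq ?addn0 // => w /andP[wy wS].
  by case: ifP => // /(parent_inj yS wS yz) E; rewrite E eqxx in wy.
by rewrite big1_seq // => y /andP[_ yS]; rewrite (negbTE (no y yS)).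
Qed.

(** By [height_leftward] the lead of [y] over [w] does not shrink from [q.1] to [t]. A tie at [t]
    thus forces a tie at [q.1], and the tie-break does not depend on the abscissa. *)
Lemma owner_strict (y q w : pt) (t : R) : owner y q -> w \in S -> below q w ->
  q.1 <= t -> over y t -> over w t -> w.1 <= y.1 -> (rank t w <= rank t y)%O.
Proof.
move=> [yS /andP[yq yq2] yP] wS wq qt yt wt wy.
have {yP} := yP w wS wq.
have := height_leftward wy qt (andP wq).1 wt yq yt.
rewrite !le_rank => ? /andP[? /implyP tie]; apply/andP; split; first lra.
by apply/implyP => ?; apply: tie; lra.
Qed.

(** The point [(s, q.2)] lies above the roof of [y], so another translate [z] covers it. If [z]
    started no higher than [y], then [s] would be dominated; if it started no further right than
    [q], it would outrank the owner at [q]. *)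
Lemma covered_right_of_owner (y q : pt) : owner y q -> covers y q ->
  height y (reach y) < q.2 ->
  (forall p : pt, over y p.1 -> y.2 <= p.2 <= y.2 + 1 -> exists2 w, w \in S & covers w p) ->
  forall s, q.1 < s -> s < reach y -> height y s < q.2 ->
  exists z, [/\ z \in S, q.1 < z.1, z.1 <= s, y.2 < z.2 & z.2 <= q.2].
Proof.
move=> own cov hr full s qs sr hs.
have [yS /andP[yq yq2] yP] := own.
have [ry1 ry2] := andP (reach_bound y).
have [yq1 yq1'] := andP yq.
have ys : over y s by apply/andP; split; lra.
have qtop : q.2 <= y.2 + 1.
  case/andP: cov => _; rewrite /height => h; apply: (le_trans h).
  by have := @profile_le1 _ f hf (q.1 - y.1); lra.
have [||z zS] := full (s, q.2); rewrite ?yq2 ?qtop // /covers /below /=.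
move=> /andP[/andP[zs zq] qz]; have [zs1 zs2] := andP zs.
have yz2 : y.2 < z.2.
  rewrite ltNge; apply/negP => zy; apply: (reach_lt sr); split => //.
  by exists z; split => //; lra.
exists z; split => //.
rewrite ltNge; apply/negP => zq1.
have bz : below q z by rewrite /below /over zq1 zq; lra.
have := yP z zS bz; rewrite le_rank => /andP[hzy /implyP tie].
have : height y q.1 <= height z q.1.
  have [zy|yz] := leP z.1 y.1.
    have := height_leftward zy (ltW qs) (andP bz).1 zs yq ys; lra.
  by apply: height_le => //; [exact: ltW | exact: ltW | case/andP: bz].
by move=> /tie /andP[]; lra.
Qed.

(** Either the rectangle ending at the reach contains [q], or the roof of [y] at the reach is below
    [q]. In the second case the leftmost translate starting between [q] and the reach, above the
    base of [y] and no higher than [q], has [y] as its parent and supplies the corner. *)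
Lemma exists_corner (y q : pt) : owner y q -> covers y q ->
  (forall p : pt, over y p.1 -> y.2 <= p.2 <= y.2 + 1 -> exists2 w, w \in S & covers w p) ->
  exists2 s, s \in widths y & q.1 - y.1 <= s /\ q.2 <= y.2 + f s.
Proof.
move=> own cov full.
have [yS /andP[yq yq2] yP] := own.
have [ry1 ry2] := andP (reach_bound y).
have [yq1 yq1'] := andP yq.
have qr := owner_reach own.
have qh : q.2 <= height y q.1 by case/andP: cov.
have [hr|hr] := leP q.2 (height y (reach y)).
  by exists (reach y - y.1); rewrite ?mem_head //; split => //; lra.
have qr' : q.1 < reach y.
  by rewrite lt_neqAle qr andbT; apply/eqP => E; rewrite -E in hr; lra.
(* Stepping back from [t] by left continuity makes the next translate found start strictly before
   [t]; this contradicts minimality below if the roof at [z.1] is under [q]. *)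
have descend t : q.1 < t -> t <= reach y -> height y t < q.2 ->
    exists s, [/\ q.1 < s, s < t & height y s < q.2].
  move=> qt tr ht; rewrite /height in qh ht *.
  have [||||| s /andP[s1 s2] fs] := @profile_left_cont _ f hf (q.1 - y.1) (t - y.1) (q.2 - y.2).
  - lra.
  - lra.
  - lra.
  - lra.
  - lra.
  by exists (s + y.1); split; [lra | lra | rewrite addrK; lra].
pose Z := [seq z <- S | [&& q.1 < z.1, z.1 < reach y, y.2 < z.2 & z.2 <= q.2]].
have findZ t : q.1 < t -> t <= reach y -> height y t < q.2 -> exists2 z, z \in Z & z.1 < t.
  move=> qt tr ht; have [s [qs st hs]] := descend t qt tr ht.
  have [|z [zS ? ? ? ?]] := covered_right_of_owner own cov hr full qs _ hs; first lra.
  by exists z; [rewrite mem_filter zS andbT; apply/and4P; split; lra | lra].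
have [z0 z0Z _] := findZ (reach y) qr' (lexx _) hr.
have [|z] := @exists_seq_max _ _ _ (fun z : pt => - z.1) Z; first by apply/eqP => Z0; rewrite Z0 in z0Z.
rewrite mem_filter => /andP[/and4P[qz zr yz zq] zS] zmin.
have zmin' w : w \in Z -> z.1 <= w.1 by move=> /zmin; rewrite lerN2.
have hz : q.2 <= height y z.1.
  rewrite leNgt; apply/negP => hz; have [w /zmin'] := findZ z.1 qz (ltW zr) hz; lra.
exists (z.1 - y.1); last by split; [lra | exact: hz].
rewrite inE; apply/orP; right; apply/mapP; exists z => //.
rewrite mem_filter zS andbT; apply/andP; split; first by apply/and3P; split; lra.
apply/allP => w wS; apply/implyP => /and3P[wz1 wz1' wz2].
have wz : over w z.1 by apply/andP; split; lra.
have yz1 : over y z.1 by apply/andP; split; lra.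
(* A rival starting to the right of [q] cannot start above the base of [y], because [z] is leftmost
   in [Z]; starting no higher, it cannot rise above [y] before the reach. *)
have [wq|qw] := leP w.1 q.1; last first.
  have wy2 : w.2 <= y.2.
    rewrite leNgt; apply/negP => yw2.
    suff /zmin' : w \in Z by lra.
    by rewrite mem_filter wS andbT; apply/and4P; split; lra.
  have nd := @reach_lt y z.1 zr.
  rewrite le_rank; apply/andP; split.
    by rewrite leNgt; apply/negP => h; apply: nd; split => //; exists w; split.
  apply/implyP => _; rewrite wy2 /=; apply/implyP => _; lra.
(* The remaining rivals also competed for [q], so the ownership of [q] decides, except that one
   starting right of [y] and no higher is again excluded by the reach. *)
have bw : below q w by apply/andP; split; [apply/andP; split; lra | lra].
have [wy|yw] := leP w.1 y.1.
  by apply: (owner_strict own wS bw) => //; exact: ltW.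
have [wy2|yw2] := leP w.2 y.2.
  have nd := @reach_lt y z.1 zr.
  rewrite le_rank; apply/andP; split.
    by rewrite leNgt; apply/negP => h; apply: nd; split => //; exists w; split.
  by apply/implyP => _; rewrite wy2 /=; apply/implyP => _; lra.
have := yP w wS bw; rewrite le_rank => /andP[_ /implyP tie].
have /tie /andP[wy _] : height y q.1 <= height w q.1; last first.
  by have := lt_le_trans yw2 wy; rewrite ltxx.
by apply: height_le => //; [exact: ltW | exact: ltW | case/andP: bw].
Qed.

End Staircase.

(** * Measures of finite unions *)

Section FiniteFamilies.
Context d (T : measurableType d) (R : realType) (mu : {measure set T -> \bar R}).
Variables (I : eqType) (F : I -> set T).

Definition union_on (s : seq I) : set T := [set q | exists2 i, i \in s & F i q].

Lemma union_on_cons (i : I) (s : seq I) : union_on (i :: s) = F i `|` union_on s.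
Proof.
apply/seteqP; split => q.
  by move=> [j]; rewrite inE => /orP[/eqP ->|js] Fq; [left | right; exists j].
by move=> [Fq|[j js Fq]]; [exists i; rewrite ?mem_head | exists j; rewrite ?inE ?js ?orbT].
Qed.

Lemma measurable_union_on (s : seq I) : {in s, forall i, measurable (F i)} ->
  measurable (union_on s).
Proof.
elim: s => [_|i s IH mF].
  by rewrite (_ : union_on [::] = set0) //; apply/seteqP; split => q // -[].
rewrite union_on_cons; apply: measurableU; first exact/mF/mem_head.
by apply: IH => j js; apply: mF; rewrite inE js orbT.
Qed.

Lemma measure_union_on_le (s : seq I) : {in s, forall i, measurable (F i)} ->
  (mu (union_on s) <= \sum_(i <- s) mu (F i))%E.
Proof.
elim: s => [_|i s IH mF].
  rewrite (_ : union_on [::] = set0) ?measure0 ?big_nil //.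
  by apply/seteqP; split => q // -[].
have mF' : {in s, forall i, measurable (F i)}.
  by move=> j js; apply: mF; rewrite inE js orbT.
rewrite union_on_cons big_cons.
apply: (le_trans (measureU2 _ _ _)); last exact: leeD2l (IH mF').
  exact/mF/mem_head.
exact: measurable_union_on.
Qed.

Lemma measure_disjoint_union (s : seq I) : uniq s ->
  {in s, forall i, measurable (F i)} ->
  {in s &, forall i j, i != j -> F i `&` F j = set0} ->
  mu (union_on s) = (\sum_(i <- s) mu (F i))%E.
Proof.
elim: s => [_ _ _|i s IH /= /andP[is_ us] mF dis].
  rewrite (_ : union_on [::] = set0) ?measure0 ?big_nil //.
  by apply/seteqP; split => q // -[].
have mF' : {in s, forall i, measurable (F i)}.
  by move=> j js; apply: mF; rewrite inE js orbT.
have dis' : {in s &, forall i j, i != j -> F i `&` F j = set0}.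
  by move=> j k js ks; apply: dis; rewrite inE ?js ?ks orbT.
have mi : measurable (F i) by exact/mF/mem_head.
rewrite union_on_cons big_cons -(IH us mF' dis').
apply: measureU => //; first exact: measurable_union_on.
apply/seteqP; split => // q [Fi [j js Fj]].
have ij : i != j by apply: contraNneq is_ => ->.
have <- : F i `&` F j = set0 by apply: dis; rewrite ?mem_head // inE js orbT.
by [].
Qed.

End FiniteFamilies.

(** * Translation-invariant measures: packings and null segments *)

Section InvariantMeasure.
Variables (R : realType) (mu : {measure set (mplane R) -> \bar R}).
Hypothesis mu_translate : forall (S : set (mplane R)) (v : plane R),
  measurable S -> mu (translate S v) = mu S.
Hypothesis mu_box : (mu (`[0%R, 2%R] `*` `[0%R, 2%R]) < +oo)%E.

Lemma packing_bound (s : seq (plane R)) (T E : set (mplane R)) : uniq s ->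
  measurable T -> measurable E ->
  {in s &, forall x y, x != y -> translate T x `&` translate T y = set0} ->
  {in s, forall x, translate T x `<=` E} ->
  (\sum_(x <- s) mu T <= mu E)%E.
Proof.
move=> us mT mE dis sub.
have mtr x : measurable (translate T x : set (mplane R)) by exact: measurable_translate.
have -> : (\sum_(x <- s) mu T = \sum_(x <- s) mu (translate T x))%E.
  by apply: eq_bigr => x _; rewrite mu_translate.
rewrite -(@measure_disjoint_union _ _ _ mu _ (fun x => translate T x : set (mplane R))) //.
apply: le_measure; rewrite ?inE //; first exact: measurable_union_on.
by move=> q [x xs]; exact: sub.
Qed.

(** The translates by [v / (n + 1)] are disjoint and all fit into the square of side 2, which has
    finite measure; so the multiples of [mu S] are bounded. *)
Lemma null_of_disjoint_translates (S : set (mplane R)) (v : plane R) :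
  measurable S -> S `<=` `[0%R, 1%R] `*` `[0%R, 1%R] ->
  0 <= v.1 <= 1 -> 0 <= v.2 <= 1 ->
  (forall t u : R, 0 < t -> t < u -> u <= 1 ->
    translate S (t *: v) `&` translate S (u *: v) = set0) ->
  mu S = 0%E.
Proof.
move=> mS sub v1 v2 dis.
pose x (n : nat) : plane R := (n.+1%:R^-1 : R) *: v.
have pos n : 0 < (n.+1%:R^-1 : R) by rewrite invr_gt0 ltr0n.
have le1 n : (n.+1%:R^-1 : R) <= 1 by rewrite invf_le1 ?ltr0n // ler1n.
have disx m n : (m < n)%N -> translate S (x m) `&` translate S (x n) = set0.
  by move=> mn; rewrite setIC; apply: dis => //; rewrite ltf_pV2 ?posrE ?ltr0n // ltr_nat ltnS.
have bound n : (mu S *+ n <= mu (`[0%R, 2%R] `*` `[0%R, 2%R]))%E.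
  have -> : (mu S *+ n = \sum_(i <- iota 0 n) mu (translate S (x i)))%E.
    rewrite (eq_bigr (fun=> mu S)) => [|i _]; last exact: mu_translate.
    by rewrite big_const_seq count_predT size_iota iter_addr_0.
  rewrite -(@measure_disjoint_union _ _ _ mu _ (fun i => translate S (x i) : set (mplane R))).
  - apply: le_measure; rewrite ?inE.
    + apply: measurable_union_on => i _; exact: measurable_translate.
    + exact: measurableX.
    move=> q [i _ [[a b] Sab <-]]; have [] := sub _ Sab.
    rewrite /= !in_itv /= => /andP[? ?] /andP[? ?].
    by have := pos i; have := le1 i; rewrite /GRing.scale /=; move: (_^-1) => r r1 r0;
      have [? ?] := andP v1; have [? ?] := andP v2; split; apply/andP; split; nra.
  - exact: iota_uniq.
  - by move=> i _; exact: measurable_translate.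
  move=> i j _ _; rewrite neq_ltn => /orP[/disx //|/disx]; by rewrite setIC.
have finS : mu S \is a fin_num.
  rewrite ge0_fin_numE //; apply: le_lt_trans mu_box.
  exact: (bound 1%N).
have finB : mu (`[0%R, 2%R] `*` `[0%R, 2%R]) \is a fin_num by rewrite ge0_fin_numE.
move: bound; rewrite -(fineK finS) -(fineK finB); set a := fine (mu S); set b := fine _ => bound.
have bound' n : a *+ n <= b by have := bound n; rewrite -EFin_natmul lee_fin.
have a0 : 0 <= a by exact: fine_ge0.
congr EFin; apply/eqP; rewrite eq_le a0 andbT leNgt; apply/negP => agt0.
have := archi_boundP (divr_ge0 (le_trans a0 (bound' 1%N)) a0).
by rewrite ltr_pdivrMr // mulr_natl ltNge bound'.
Qed.

Lemma vertical_null (c : R) : mu (([set c] `*` `[0%R, 1%R]) `&` (`[0%R, 1%R] `*` `[0%R, 1%R])) = 0%E.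
Proof.
apply: (@null_of_disjoint_translates _ (1, 0)) => /=; rewrite ?lexx ?ler01 //.
  by apply: measurableI; exact: measurableX.
move=> t u t0 tu _; apply/seteqP; split => // q.
move=> [[p [[/= p1 _] _] <-]] [p' [[/= p'1 _] _]] /(congr1 fst) /=.
by rewrite p1 p'1 /GRing.scale /= !mulr1 => /addrI; lra.
Qed.

Lemma horizontal_null (c : R) : mu ((`[0%R, 1%R] `*` [set c]) `&` (`[0%R, 1%R] `*` `[0%R, 1%R])) = 0%E.
Proof.
apply: (@null_of_disjoint_translates _ (0, 1)) => /=; rewrite ?lexx ?ler01 //.
  by apply: measurableI; exact: measurableX.
move=> t u t0 tu _; apply/seteqP; split => // q.
move=> [[p [[/= _ p1] _] <-]] [p' [[/= _ p'1] _]] /(congr1 snd) /=.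
by rewrite p1 p'1 /GRing.scale /= !mulr1 => /addrI; lra.
Qed.

(** * Unions of rectangles under the profile *)

Variable f : R -> R.
Hypothesis hf : quarter_profile f.

Definition rect (s : R) : set (mplane R) := `[0, s] `*` `[0, f s].

(** Not a convex hull: a staircase-shaped region made of rectangles that share the corner at the
    origin. *)
Definition hull (B : seq R) : set (mplane R) := union_on rect B.

(* [hull [:: a; b]] without its upper and right edges, so that it tiles *)
Definition ltile (a b : R) : set (mplane R) :=
  (`[0, b[ `*` `[0, f b[) `|` (`[0, a[ `*` `[0, f a[).

Lemma measurable_rect (s : R) : measurable (rect s).
Proof. exact: measurableX. Qed.

Lemma measurable_hull (B : seq R) : measurable (hull B).
Proof. by apply: measurable_union_on => s _; exact: measurable_rect. Qed.

Lemma measurable_ltile (a b : R) : measurable (ltile a b).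
Proof. by apply: measurableU; exact: measurableX. Qed.

Lemma rect_subgraph (s : R) : 0 <= s <= 1 -> rect s `<=` subgraph f.
Proof.
move=> /andP[s0 s1] [x y] [] /=; rewrite !in_itv /= => /andP[? ?] /andP[? yf].
split => /=; first by apply/andP; split; lra.
by have := @profile_mono _ f hf x s ltac:(lra) ltac:(lra) s1; lra.
Qed.

Lemma subgraph_box : subgraph f `<=` `[0%R, 1%R] `*` `[0%R, 1%R].
Proof.
move=> [x y] [/= x01 /andP[y0 yf]]; split => /=; rewrite in_itv //=.
by have [x0 x1] := andP x01; have := @profile_le1 _ f hf x x0 x1; lra.
Qed.

Lemma hull_subgraph (B : seq R) : {in B, forall s, 0 <= s <= 1} -> hull B `<=` subgraph f.
Proof. by move=> B01 q [s sB]; exact: rect_subgraph (B01 s sB) q. Qed.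

Lemma ltile_subgraph (a b : R) : 0 <= a <= 1 -> 0 <= b <= 1 -> ltile a b `<=` subgraph f.
Proof.
move=> a01 b01 [x y] [] [] /=; rewrite !in_itv /= => ? ?.
  by apply: (rect_subgraph b01); split; rewrite /= in_itv /=; lra.
by apply: (rect_subgraph a01); split; rewrite /= in_itv /=; lra.
Qed.

Lemma mu_subgraph_fin (S : set (mplane R)) : measurable S -> S `<=` subgraph f ->
  mu S \is a fin_num.
Proof.
move=> mS sub; rewrite ge0_fin_numE //; apply: le_lt_trans mu_box.
apply: le_measure; rewrite ?inE //; first exact: measurableX.
move=> q /sub /subgraph_box [] /=; rewrite !in_itv /= => ? ?.
by split; lra.
Qed.

(** The points lost lie on the right and upper edges of the two rectangles, and these segments are
    null. *)
Lemma mu_hull2_ltile (a b : R) : 0 <= a <= 1 -> 0 <= b <= 1 ->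
  (mu (hull [:: a; b]) <= mu (ltile a b))%E.
Proof.
move=> a01 b01.
pose box : set (mplane R) := `[0%R, 1%R] `*` `[0%R, 1%R].
pose ver (c : R) : set (mplane R) := ([set c] `*` `[0%R, 1%R]) `&` box.
pose hor (c : R) : set (mplane R) := (`[0%R, 1%R] `*` [set c]) `&` box.
have mbox : measurable box by exact: measurableX.
have mver c : measurable (ver c) by apply: measurableI => //; exact: measurableX.
have mhor c : measurable (hor c) by apply: measurableI => //; exact: measurableX.
have ver0 c : mu (ver c) = 0%E by exact: vertical_null.
have hor0 c : mu (hor c) = 0%E by exact: horizontal_null.
have mE : measurable ((ver a `|` ver b) `|` (hor (f a) `|` hor (f b))).
  by apply: measurableU; apply: measurableU.
have E0 : mu ((ver a `|` ver b) `|` (hor (f a) `|` hor (f b))) = 0%E.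
  have null2 A B : measurable A -> measurable B -> mu A = 0%E -> mu B = 0%E -> mu (A `|` B) = 0%E.
    by move=> mA mB A0 B0; apply: null_set_setU.
  by apply: (null2); [exact: measurableU|exact: measurableU|apply: (null2)|apply: (null2)].
have mt := measurable_ltile a b.
have := measureU2 mu mt mE; rewrite [X in (_ <= _ + X)%E]E0 adde0; apply: le_trans.
apply: le_measure; rewrite ?inE; first exact: measurable_hull.
  by apply: measurableU => //; exact: measurable_ltile.
move=> [x y] [s]; rewrite !inE => sab Hs.
have s01 : 0 <= s <= 1 by case/orP: sab => /eqP ->.
have Hb : box (x, y) by apply: subgraph_box; exact: (rect_subgraph s01).
case: Hs => /=; rewrite !in_itv /= => /andP[x0 xs] /andP[y0 ys].
have [[/= xb yb] _] := (Hb, Hb).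
have [Ex|nx] := eqVneq x s.
  right; left; case/orP: sab => /eqP E; [left|right]; split => //; split => //=; by rewrite Ex E.
have [Ey|ny] := eqVneq y (f s).
  right; right; case/orP: sab => /eqP E; [left|right]; split => //; split => //=; by rewrite Ey E.
have xs' : x < s by rewrite lt_neqAle nx.
have ys' : y < f s by rewrite lt_neqAle ny.
by left; case/orP: sab => /eqP E; rewrite E in xs' ys'; [right|left]; split;
  rewrite /= in_itv /= ?x0 ?y0.
Qed.

Definition hull_area (B : seq R) : R := fine (mu (hull B)).

Lemma hull_areaE (B : seq R) : {in B, forall s, 0 <= s <= 1} ->
  mu (hull B) = (hull_area B)%:E.
Proof.
move=> B01; rewrite fineK //; apply: mu_subgraph_fin; first exact: measurable_hull.
exact: hull_subgraph.
Qed.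

Lemma hull_area_perm (B C : seq R) : perm_eq B C -> hull_area B = hull_area C.
Proof.
move=> BC; congr (fine (mu _)); apply/seteqP.
by split => q [s sB rs]; exists s => //; rewrite ?(perm_mem BC) // -(perm_mem BC).
Qed.

Lemma rect_between (a b c : R) : 0 <= a <= 1 -> 0 <= b <= 1 -> 0 <= c <= 1 ->
  (b <= c <= a) || (a <= c <= b) -> rect a `&` rect b `<=` rect c.
Proof.
move=> /andP[? ?] /andP[? ?] /andP[? ?] H [x y] [[/= + +] [/= + +]].
rewrite !in_itv /= => /andP[? ?] /andP[? ?] /andP[? ?] /andP[? ?].
case/orP: H => /andP[? ?]; split; rewrite /= in_itv /=; apply/andP; split; try lra.
  by have := @profile_mono _ f hf c a; lra.
by have := @profile_mono _ f hf c b; lra.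
Qed.

(* The part of [rect b] outside [rect c] and the other rectangles is also outside
   [rect a]. *)
Lemma hull_area_exchange (a b c : R) (B : seq R) :
  {in [:: a, b, c & B], forall s, 0 <= s <= 1} -> (b <= c <= a) || (a <= c <= b) ->
  hull_area [:: b, c & B] + hull_area [:: a] <= hull_area (c :: B) + hull_area [:: a; b].
Proof.
move=> in01 btw.
have i1 s : s \in [:: b, c & B] -> 0 <= s <= 1 by move=> H; apply: in01; rewrite inE H orbT.
have i2 s : s \in c :: B -> 0 <= s <= 1 by move=> H; apply: i1; rewrite inE H orbT.
have a01 : 0 <= a <= 1 by apply: in01; rewrite mem_head.
have b01 : 0 <= b <= 1 by apply: i1; rewrite mem_head.
have c01 : 0 <= c <= 1 by apply: i2; rewrite mem_head.
rewrite -lee_fin !EFinD -!hull_areaE //; last 2 first.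
- by move=> s; rewrite !inE => /orP[/eqP ->|/eqP ->].
- by move=> s; rewrite !inE => /eqP ->.
have mr := measurable_rect; have mh := measurable_hull.
have split_hull s C : mu (hull (s :: C)) = (mu (hull C) + mu (rect s `\` hull C))%E.
  rewrite (@measureDI _ _ _ mu _ _ (mh (s :: C)) (mh C)) addeC.
  by rewrite /hull union_on_cons setDUl setDv setU0 setIidr //; exact: subsetUr.
have -> : hull [:: a; b] = hull [:: b; a].
  by rewrite /hull !union_on_cons setUCA.
rewrite (split_hull b) (split_hull b [:: a]) -addeA; apply: leeD2l.
rewrite addeC; apply: leeD2l.
apply: le_measure; rewrite ?inE; [exact: measurableD..|].
move=> q [qb nq]; split => // -[a']; rewrite inE => /eqP -> qa; apply: nq.
by exists c; [exact: mem_head | exact: (rect_between a01 b01 c01 btw)].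
Qed.

(** Among three widths, two lie on the same side of [a]. The farther one is [b]; the nearer one
    plays the role of [c] in [hull_area_exchange] and remains in [C]. *)
Lemma exists_exchange (a : R) (B : seq R) : 0 <= a <= 1 -> {in B, forall s, 0 <= s <= 1} ->
  (2 < size B)%N -> exists b, exists C,
  perm_eq B (b :: C) /\ hull_area B + hull_area [:: a] <= hull_area C + hull_area [:: a; b].
Proof.
move=> a01 B01 sB.
have step b c C : perm_eq B [:: b, c & C] -> (b <= c <= a) || (a <= c <= b) ->
    exists b, exists C, perm_eq B (b :: C) /\
      hull_area B + hull_area [:: a] <= hull_area C + hull_area [:: a; b].
  move=> BC btw; exists b, (c :: C); split => //.
  rewrite (hull_area_perm BC); apply: hull_area_exchange btw.
  move=> s; rewrite inE => /orP[/eqP ->//|sC]; apply: B01.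
  by rewrite (perm_mem BC).
have pick b c C : perm_eq B [:: b, c & C] -> (b <= a) && (c <= a) || (a <= b) && (a <= c) ->
    exists b, exists C, perm_eq B (b :: C) /\
      hull_area B + hull_area [:: a] <= hull_area C + hull_area [:: a; b].
  move=> BC side.
  have BC' : perm_eq B [:: c, b & C].
    by apply: (perm_trans BC); rewrite -[[:: b, c & C]]/([:: b; c] ++ C) (perm_catCA [:: b] [:: c] C).
  have [bc|cb] := leP b c.
    by case/orP: side => /andP[? ?]; [apply: (step b c C BC) | apply: (step c b C BC')]; lra.
  by case/orP: side => /andP[? ?]; [apply: (step c b C BC') | apply: (step b c C BC)]; lra.
case: B sB B01 step pick => [//|x [//|y [//|z C]]] _ B01 _ pick.
have [xa|ax] := leP x a; have [ya|ay] := leP y a; have [za|az] := leP z a.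
- by apply: (pick x y (z :: C)) => //; lra.
- by apply: (pick x y (z :: C)) => //; lra.
- apply: (pick x z (y :: C)); last lra.
  by rewrite perm_cons (perm_catCA [:: y] [:: z] C).
- apply: (pick y z (x :: C)); last lra.
  by rewrite -[[:: x, y, z & C]]/([:: x] ++ [:: y; z] ++ C) (perm_catCA [:: x] [:: y; z] C).
- apply: (pick y z (x :: C)); last lra.
  by rewrite -[[:: x, y, z & C]]/([:: x] ++ [:: y; z] ++ C) (perm_catCA [:: x] [:: y; z] C).
- apply: (pick x z (y :: C)); last lra.
  by rewrite perm_cons (perm_catCA [:: y] [:: z] C).
- by apply: (pick x y (z :: C)) => //; lra.
- by apply: (pick x y (z :: C)) => //; lra.
Qed.

Variable m : R.
Hypothesis hull2_le : forall a b, 0 <= a <= 1 -> 0 <= b <= 1 -> hull_area [:: a; b] <= m.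

(** The value at [n = 1] of the linear bound; with a supremum no optimal width has to be found. *)
Definition rect_sup : R := sup [set hull_area [:: a] | a in `[0, 1]%classic].

Lemma rect_le2 (a : R) : 0 <= a <= 1 -> hull_area [:: a] <= m.
Proof.
move=> a01; rewrite (_ : hull_area [:: a] = hull_area [:: a; a]); first exact: hull2_le.
by rewrite /hull_area /hull !union_on_cons setUA setUid.
Qed.

Lemma rect_le_sup (a : R) : 0 <= a <= 1 -> hull_area [:: a] <= rect_sup.
Proof.
move=> a01; apply: ub_le_sup; last by exists a.
by exists m => _ [b b01 <-]; exact: rect_le2.
Qed.

Lemma rect_sup_le (x : R) : (forall a, 0 <= a <= 1 -> hull_area [:: a] <= x) -> rect_sup <= x.
Proof.
move=> ub; apply: ge_sup; last by move=> _ [a a01 <-]; exact: ub.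
by exists (hull_area [:: 0]), 0; rewrite //= in_itv /= lexx ler01.
Qed.

(** Induction on the number of widths, starting from one and two. In a longer list [exists_exchange]
    removes a width at a cost of at most [m - hull_area [:: a]], whatever [a] is; the supremum over
    [a] turns this cost into [m - rect_sup]. *)
Lemma hull_area_le (B : seq R) : {in B, forall s, 0 <= s <= 1} -> (0 < size B)%N ->
  hull_area B <= rect_sup + (size B).-1%:R * (m - rect_sup).
Proof.
move: {2}(size B) (erefl (size B)) => n; elim: n B => [B -> //|n IH] B sB B01 _.
rewrite sB.
have [n2|] := ltnP 1 n; last first.
  case: n {IH} sB => [|[|//]]; case: B B01 => [//|a [|b [|//]]] // B01 _ _.
    by rewrite mul0r addr0; apply/rect_le_sup/B01/mem_head.
  rewrite mul1r addrC subrK; apply: hull2_le; apply: B01; first exact: mem_head.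
  by rewrite inE mem_head orbT.
suff : rect_sup <= rect_sup + (n.-1)%:R * (m - rect_sup) + m - hull_area B.
  rewrite /= -[in n%:R](prednK (ltnW n2)) -natr1; lra.
apply: rect_sup_le => a a01.
have [|b [C [BC le]]] := exists_exchange a01 B01; first by rewrite sB.
have sC : size C = n by apply/eqP; rewrite -eqSS -sB (perm_size BC).
have C01 : {in C, forall s, 0 <= s <= 1}.
  by move=> s sC'; apply: B01; rewrite (perm_mem BC) inE sC' orbT.
have := IH C sC C01; rewrite sC (ltnW n2) => /(_ isT).
have b01 : 0 <= b <= 1 by apply: B01; rewrite (perm_mem BC) mem_head.
have := hull2_le a01 b01; lra.
Qed.

(** Each [y] contributes one rectangle plus one per child, and there are at most [size S] children
    in all. By [hull_area_le] the total is at most [size S] times [rect_sup + (m - rect_sup)]. *)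
Lemma staircase_bound (S : seq (R * R)) (E : set (mplane R)) : uniq S -> measurable E ->
  (forall q, E q -> exists2 y : R * R, y \in S & translate (hull (widths f S y)) y q) ->
  (mu E <= ((size S)%:R * m)%:E)%E.
Proof.
move=> uS mE cov.
pose F (y : R * R) : set (mplane R) := translate (hull (widths f S y)) y.
have mF y : measurable (F y) by apply: measurable_translate; exact: measurable_hull.
apply: (@le_trans _ _ (mu (union_on F S))).
  by apply: le_measure; rewrite ?inE //; apply: measurable_union_on.
apply: (le_trans (measure_union_on_le _ _)) => //.
rewrite (eq_bigr (fun y => (hull_area (widths f S y))%:E)); last first.
  move=> y _; rewrite mu_translate; last exact: measurable_hull.
  by rewrite hull_areaE //; exact: widths01.
rewrite sumEFin lee_fin.
pose k (y : R * R) := size [seq z <- S | parent f S y z].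
apply: (@le_trans _ _ (\sum_(y <- S) (rect_sup + (k y)%:R * (m - rect_sup)))).
  apply: ler_sum => y _; apply: (le_trans (hull_area_le (@widths01 _ f S y) _)) => //.
  by rewrite /= size_map.
have mr : 0 <= m - rect_sup by rewrite subr_ge0; apply: rect_sup_le; exact: rect_le2.
rewrite big_split /= -mulr_suml -natr_sum big_const_seq count_predT iter_addr_0.
rewrite -[rect_sup *+ _]mulr_natl.
have : ((\sum_(y <- S) k y)%N)%:R * (m - rect_sup) <= (size S)%:R * (m - rect_sup).
  by apply: ler_wpM2r => //; rewrite ler_nat; exact: sum_parents.
lra.
Qed.

End InvariantMeasure.

(** * Lattice tilings by L-shapes *)

Lemma int_cases (R : realType) (k : int) : [\/ (k%:~R : R) <= -1, k = 0 | 1 <= (k%:~R : R)].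
Proof.
case: k => [[|n]|n]; first exact: Or32.
  by apply: Or33; rewrite -pmulrn ler1n.
by apply: Or31; rewrite NegzE mulrNz lerN2 -pmulrn ler1n.
Qed.

Lemma int_crossing (R : realType) (u : int -> R) (y : R) (i : int) (n : nat) :
  u i <= y -> y < u (i + n%:Z) -> exists k, u k <= y /\ y < u (k + 1).
Proof.
move=> ui; elim: n => [|n IH]; first by rewrite addr0 => /(le_lt_trans ui); rewrite ltxx.
have [yu _|uy yu] := ltP y (u (i + n%:Z)); first exact: IH.
by exists (i + n%:Z); split => //; rewrite -addrA -PoszD addn1.
Qed.

Section LTile.
Variables (R : realType) (f : R -> R) (a b : R).

(** The basis is [(a, f b)], [(b, f b - f a)]. Up to sign its determinant is
    [b * f b + a * (f a - f b)], the area of the L-shape when [a <= b]. *)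
Definition lvec (m n : R) : R * R := (m * a + n * b, m * f b + n * (f b - f a)).

Lemma ltileP (x y : R) : a <= b -> f b <= f a -> ltile f a b (x, y) <->
  [/\ 0 <= x, 0 <= y, x < b, y < f a & x < a \/ y < f b].
Proof.
move=> ab fab; split.
  case=> -[] /=; rewrite !in_itv /= => /andP[x0 xs] /andP[y0 ys].
    by split => //; [exact: lt_le_trans fab | right].
  by split => //; [exact: lt_le_trans ab | left].
case=> x0 y0 xb ya [xa|yb].
  by right; split; rewrite /= in_itv /= ?x0 ?y0.
by left; split; rewrite /= in_itv /= ?x0 ?y0.
Qed.

(** A shift with [m >= 1] and [n = 0] passes the inner corner [(a, f b)]; one with [m >= 0] and
    [n >= 1] passes the width [b]; one with [m >= 1] and [n <= -1] passes the height [f a].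
    Exchanging [p] and [q] gives the other cases. *)
Lemma ltile_disjoint (p q : R * R) (m n : int) : 0 <= a -> a <= b -> 0 <= f b -> f b <= f a ->
  ltile f a b p -> ltile f a b q -> p = q + lvec m%:~R n%:~R -> m = 0 /\ n = 0.
Proof.
move=> a0 ab fb0 fab; case: p q => [p1 p2] [q1 q2].
move=> /(ltileP _ _ ab fab)[? ? ? ? Hp] /(ltileP _ _ ab fab)[? ? ? ? Hq] [E1 E2].
have b0 : 0 <= b by lra.
have e0 : 0 <= f a - f b by lra.
have P (x y z : R) : 0 <= y -> z <= x -> z * y <= x * y by move=> *; exact: ler_wpM2r.
have [n1|nz|n1] := int_cases R n; have [m1|mz|m1] := int_cases R m => //;
  exfalso; move: E1 E2; rewrite ?nz ?mz ?mul0r ?addr0 ?add0r;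
  try (have := P _ _ _ b0 n1; have := P _ _ _ e0 n1);
  try (have := P _ _ _ a0 m1; have := P _ _ _ fb0 m1);
  case: Hp => ?; case: Hq => ?; lra.
Qed.

(* Consecutive tiles of a vertical line are stacked: moving by [(a - b, f a)] and
   correcting the abscissa by a multiple of [(b, f b - f a)], the base of the next
   tile is the roof of the current one. *)
Lemma ltile_cover (p : R * R) : 0 <= a -> a <= b -> 0 <= f b -> f b <= f a ->
  0 < b * f b + a * (f a - f b) -> exists m n : int, ltile f a b (p - lvec m%:~R n%:~R).
Proof.
move=> a0 ab fb0 fab D0; have b0 : 0 < b.
  rewrite lt_neqAle (le_trans a0 ab) andbT; apply/eqP => b0.
  have az : a = 0 by apply/le_anti; rewrite a0 andbT [X in _ <= X]b0.
  by move: D0; rewrite -b0 az !mul0r addr0 ltxx.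
case: p => x y.
pose c := b - a; pose e := f a - f b.
have e0 : 0 <= e by rewrite /e; lra.
pose N (k : int) : int := Num.floor ((x + k%:~R * c) / b).
pose base (k : int) : R := k%:~R * f a - (N k)%:~R * e.
pose xi (k : int) : R := x + k%:~R * c - (N k)%:~R * b.
have xi01 k : 0 <= xi k < b.
  have := Num.Theory.floor_itv ((x + k%:~R * c) / b).
  rewrite -/(N k) ler_pdivlMr // ltr_pdivrMr // intrD /xi.
  by move: ((N k)%:~R) => z; lra.
have step k : base (k + 1) = base k + (if xi k < a then f a else f b).
  have NE (z : int) : (z%:~R : R) * b <= x + (k%:~R + 1) * c < (z%:~R + 1) * b -> N (k + 1) = z.
    move=> H; apply/Num.Theory.floor_def.
    by rewrite ler_pdivlMr // ltr_pdivrMr // !intrD.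
  have [x0 xb] := andP (xi01 k); rewrite /base; case: ifP => [xa|/negbT xa].
    rewrite (NE (N k)); first by rewrite intrD; lra.
    by move: xa x0 xb; rewrite /xi /c; lra.
  rewrite -leNgt in xa.
  rewrite (NE (N k + 1)); first by rewrite !intrD /e; lra.
  by rewrite intrD; move: xa x0 xb; rewrite /xi /c; lra.
(* Up to a bounded error [base k * b] is [k] times the area of the tile, which is positive; so
   [base] takes values on both sides of [y]. *)
have bound k : k%:~R * (b * f b + a * (f a - f b)) - x * e <= base k * b <=
    k%:~R * (b * f b + a * (f a - f b)) - x * e + b * e.
  have [x0 xb] := andP (xi01 k).
  have := ler_wpM2r e0 x0; have := ler_wpM2r e0 (ltW xb).
  by rewrite mul0r /base /xi /c /e; lra.
move: bound; set D := b * f b + _ => bound.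
have arch (z : R) : exists n : nat, z < n%:R * D.
  exists (Num.bound `|z / D|); rewrite -ltr_pdivrMr //.
  exact: le_lt_trans (ler_norm _) (archi_boundP (normr_ge0 _)).
have [i bi] : exists i : nat, base (- i%:Z) <= y.
  have [i Hi] := arch (b * e - x * e - y * b).
  exists i; rewrite -(ler_pM2r b0).
  by have := bound (- i%:Z); rewrite mulrNz -pmulrn; lra.
have [j bj] : exists j : nat, y < base j%:Z.
  have [j Hj] := arch (y * b + x * e).
  exists j; rewrite -(ltr_pM2r b0).
  by have := bound j%:Z; rewrite -pmulrn; lra.
have [|k [k1 k2]] := @int_crossing _ base y (- i%:Z) (i + j)%N bi; first by rewrite PoszD addKr.
(* These are the coordinates of [k] times [(a - b, f a)] plus [N k] times [(b, f b - f a)]. *)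
exists k, (N k - k).
have [x0 xb] := andP (xi01 k).
have -> : (x, y) - lvec k%:~R (N k - k)%:~R = (xi k, y - base k).
  by rewrite /lvec intrB /xi /base /c /e; congr (_, _) => /=; ring.
move: k2; rewrite step; case: ifP => [xa k2|/negbT xa k2].
  by apply/ltileP => //; split; [lra|lra|lra|lra|left].
rewrite -leNgt in xa.
by apply/ltileP => //; split; [lra|lra|lra|lra|right; lra].
Qed.

End LTile.

(** * Linear maps, disks and discrete sets in the plane *)

Section PlaneMaps.
Variable R : realType.

Lemma plane_linearE (L : plane R -> plane R) (p : plane R) : linear L ->
  L p = (p.1 * (L (1, 0)).1 + p.2 * (L (0, 1)).1, p.1 * (L (1, 0)).2 + p.2 * (L (0, 1)).2).
Proof.
move=> linL.
have L0 : L 0 = 0.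
  by have := linL (-1) 0 0; rewrite scaler0 addr0 scaleN1r addNr.
have LZ k u : L (k *: u) = k *: L u by have := linL k u 0; rewrite L0 !addr0.
have {1}-> : p = p.1 *: ((1, 0) : plane R) + p.2 *: ((0, 1) : plane R).
  by case: p => x y; congr (_, _) => /=; rewrite /GRing.scale /= ?mulr0 ?mulr1 ?addr0 ?add0r.
by rewrite linL LZ.
Qed.

Lemma measurable_affine_map (L : plane R -> plane R) (c d : plane R) : linear L ->
  measurable_fun [set: mplane R] (fun p : mplane R => (L (p - c) + d : mplane R)).
Proof.
move=> linL.
have := measurable_affine (L (1, 0)).1 (L (0, 1)).1 ((L (- c)).1 + d.1)
  (L (1, 0)).2 (L (0, 1)).2 ((L (- c)).2 + d.2).
apply: eq_measurable_fun => p _.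
have -> : L (p - c) = L p + L (- c) by have := linL 1 p (- c); rewrite !scale1r.
rewrite [L p]plane_linearE //; case: (L (- c)) (d) => [x y] [z t].
by congr (_, _) => /=; rewrite -!addrA; congr (_ + _); rewrite mulrC // ?[_ * p.2]mulrC.
Qed.

(** Coordinates bounded by [d] give a Euclidean length of at most [d] times the root of 2; the
    factor 2 avoids the root. *)
Lemma disk_shift (r d : R) (p v : plane R) : 0 <= r -> `|v.1| <= d -> `|v.2| <= d ->
  euclidean_disk r p -> euclidean_disk (r + 2 * d) (p + v).
Proof.
case: p v => [x y] [a b] r0 /= va vb; rewrite /euclidean_disk /= => xy.
have d0 : 0 <= d := le_trans (normr_ge0 _) va.
have xr : `|x| <= r.
  by rewrite -(ger0_norm r0); apply: norm_le_of_sqr; have := sqr_ge0 y; lra.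
have yr : `|y| <= r.
  by rewrite -(ger0_norm r0); apply: norm_le_of_sqr; have := sqr_ge0 x; lra.
have cross (s t : R) : `|s| <= r -> `|t| <= d -> s * t <= r * d.
  move=> sr td; apply: (le_trans (ler_norm _)); rewrite normrM.
  by apply: ler_pM.
have sq (t : R) : `|t| <= d -> t ^+ 2 <= d ^+ 2.
  by move=> td; rewrite -[t ^+ 2]real_normK ?num_real // ler_sqr ?nnegrE.
have := cross x a xr va; have := cross y b yr vb; have := sq a va; have := sq b vb.
by have := mulr_ge0 r0 d0; have := sqr_ge0 d; rewrite !sqrrD; nra.
Qed.

(** Meant for lattices, where the two forms are multiples of the integer coordinates. On a ball of
    radius [e / M] both forms stay below [e]. *)
Lemma discrete_of_forms (X : set (plane R)) (a b c d e : R) : 0 < e ->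
  (forall x y, X x -> X y -> `|a * (y - x).1 + b * (y - x).2| < e ->
    `|c * (y - x).1 + d * (y - x).2| < e -> y = x) -> discrete_set X.
Proof.
move=> e0 sep x Xx; split; first by rewrite inE.
pose M := `|a| + `|b| + (`|c| + `|d|) + 1.
have M0 : 0 < M by rewrite /M ltr_wpDl // !addr_ge0.
have eM : 0 < e / M by rewrite divr_gt0.
exists (ball x (e / M)); first exact: nbhsx_ballx.
have small (s t z w : R) : `|s| + `|t| < M -> `|z| < e / M -> `|w| < e / M -> `|s * z + t * w| < e.
  move=> st zM wM; apply: (le_lt_trans (ler_normD _ _)); rewrite !normrM.
  apply: (@le_lt_trans _ _ ((`|s| + `|t|) * (e / M))).
    by rewrite mulrDl lerD // ler_wpM2l // ltW.
  by rewrite mulrCA -[ltRHS]mulr1 ltr_pM2l // ltr_pdivrMr // mul1r.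
apply/seteqP; split => [y [[/= y1 y2] Xy]|_ ->]; last by split => //; exact: ballxx.
move: y1 y2; rewrite /ball /= distrC => y1; rewrite distrC => y2.
apply: sep => //; apply: small => //; rewrite /M.
  by rewrite -addrA ltrDl ltr_wpDl // addr_ge0.
by rewrite [ltRHS]addrAC ltrDr ltr_wpDl ?addr_ge0 // addr_ge0.
Qed.

Lemma intmul_pair (v : plane R) (k : int) : v *~ k = (v.1 * k%:~R, v.2 * k%:~R).
Proof.
have fstM : (v *~ k).1 = v.1 *~ k by exact: (raddfMz (@fst R^o R^o)).
have sndM : (v *~ k).2 = v.2 *~ k by exact: (raddfMz (@snd R^o R^o)).
by rewrite [LHS]surjective_pairing fstM sndM !mulrzr.
Qed.

End PlaneMaps.

(** * Transport between the disk and the coordinates of its profile *)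

Section Pullback.
Variables (R : realType) (f : R -> R).
Hypothesis hf : quarter_profile f.

Lemma measurable_subgraph : measurable (subgraph f : set (mplane R)).
Proof.
have mf : measurable_fun (`[0%R, 1%R] : set (measurableTypeR R))
    (f : measurableTypeR R -> measurableTypeR R).
  apply: subspace_continuous_measurable_fun; first exact: measurable_itv.
  by case: hf.
pose D : set (mplane R) := `[0%R, 1%R] `*` setT.
have mD : measurable D by exact: measurableX.
have m1 : measurable_fun D (fun p : mplane R => f p.1 : measurableTypeR R).
  apply: (measurable_comp _ _ mf) => //.
    by move=> _ [[x y] [/= xD _] <-].
  by apply: measurable_funTS; exact: measurable_fst.
have m2 : measurable_fun D (fun p : mplane R => p.2 : measurableTypeR R).
  by apply: measurable_funTS; exact: measurable_snd.
have m3 : measurable (D `&` [set p | p.2 <= f p.1]) by exact: measurable_fun_le.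
have m4 : measurable ((setT `*` `[0%R, +oo[) : set (mplane R)) by exact: measurableX.
rewrite (_ : (subgraph f : set (mplane R)) =
  (D `&` [set p | p.2 <= f p.1]) `&` (setT `*` `[0%R, +oo[)); first exact: measurableI.
apply/seteqP; split => [[x y]|[x y]].
  move=> [/= ? /andP[? ?]]; split; last by split; rewrite //= in_itv /= andbT.
  by split => //; split; rewrite //= in_itv.
move=> [[[/= + _] ?] [_ /=]]; rewrite !in_itv /= andbT => ? ?.
by split => //=; apply/andP.
Qed.

Variables (A : {linear plane R -> plane R}) (B : plane R -> plane R) (b0 : plane R).
Hypotheses (AK : cancel A B) (BK : cancel B A).

Let K : set (plane R) := [set A p + b0 | p in subgraph f].
(** [psi] passes to the coordinates in which the disk is [subgraph f], and [phi] is its inverse. *)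
Let psi (p : plane R) : plane R := B (p - b0).
Let phi (q : plane R) : plane R := A q + b0.

Let linB : linear B := can2_linear AK BK.

Lemma pullback_measurable : measurable_fun [set: mplane R] (psi : mplane R -> mplane R).
Proof.
have := measurable_affine_map b0 0 linB.
by apply: eq_measurable_fun => p _; rewrite addr0.
Qed.

(* Pulling the area back, instead of scaling it by a determinant, uses nothing
   but its invariance under translations. *)
Lemma exists_pullback_measure : exists mu : {measure set (mplane R) -> \bar R},
  forall S, mu S = area (psi @^-1` S).
Proof.
pose m : {measure set (mplane R) -> \bar R} :=
  pushforward (@area_measure R) (psi : mplane R -> mplane R).
by exists (m pullback_measurable).
Qed.

Lemma phiK q : psi (phi q) = q.
Proof. by rewrite /psi /phi addrK AK. Qed.

Lemma psiK p : phi (psi p) = p.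
Proof. by rewrite /psi /phi BK subrK. Qed.

Lemma psiB p x : psi (p - x) = psi p - B x.
Proof.
rewrite /psi addrAC; have := linB (-1) x (p - b0).
by rewrite !scaleN1r [- x + _]addrC [- B x + _]addrC.
Qed.

Lemma phiD q v : phi (q + v) = phi q + A v.
Proof. by rewrite /phi linearD addrAC. Qed.

Lemma translateP (S : set (plane R)) x p : translate S x p <-> S (p - x).
Proof.
by split=> [[q Sq <-]|Sp]; [rewrite addrK | exists (p - x); rewrite ?subrK].
Qed.

Lemma image_psi (S : set (plane R)) : [set A p + b0 | p in S] = psi @^-1` S.
Proof.
apply/seteqP; split=> [_ [q Sq <-]|p Sp]; first by rewrite /= -/(phi q) phiK.
by exists (psi p) => //; exact: psiK.
Qed.

Lemma translate_psi (S : set (plane R)) x :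
  translate (psi @^-1` S) x = psi @^-1` (translate S (B x)).
Proof.
by apply/seteqP; split => p; rewrite /= !translateP /= psiB.
Qed.

Lemma measurable_psi (S : set (mplane R)) : measurable S -> measurable (psi @^-1` S : set (mplane R)).
Proof. by move=> mS; rewrite -[X in measurable X]setTI; exact: pullback_measurable. Qed.

Lemma measurable_K : measurable (K : set (mplane R)).
Proof. by rewrite /K image_psi; apply: measurable_psi; exact: measurable_subgraph. Qed.

Variable mu : {measure set (mplane R) -> \bar R}.
Hypothesis muE : forall S, mu S = area (psi @^-1` S).

Lemma mu_translate (S : set (mplane R)) (v : plane R) : measurable S ->
  mu (translate S v) = mu S.
Proof.
move=> mS; rewrite !muE -[v]AK -translate_psi area_translate //.
exact: measurable_psi.
Qed.

(** Sum of the absolute entries of the matrix of [A]. It bounds the factor by which [A] enlarges the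
    sup norm, hence the extent of [K]. *)
Definition spread : R :=
  `|(A (1, 0)).1| + `|(A (0, 1)).1| + `|(A (1, 0)).2| + `|(A (0, 1)).2|.

Lemma spreadP (M : R) (u : plane R) : `|u.1| <= M -> `|u.2| <= M ->
  `|(A u).1| <= M * spread /\ `|(A u).2| <= M * spread.
Proof.
move=> u1 u2; have M0 := le_trans (normr_ge0 _) u1.
have bd (s t : R) : `|u.1 * s + u.2 * t| <= M * (`|s| + `|t|).
  apply: (le_trans (ler_normD _ _)); rewrite !normrM mulrDr.
  by apply: lerD; apply: ler_wpM2r.
rewrite (plane_linearE u (linearP A)); split; apply: (le_trans (bd _ _)); apply: ler_wpM2l => //.
  by rewrite /spread -addrA lerDl addr_ge0.
by rewrite /spread -addrA lerDr addr_ge0.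
Qed.

Lemma spread_ge0 : 0 <= spread.
Proof. by rewrite /spread !addr_ge0. Qed.

Lemma mu_box : (mu (`[0%R, 2%R] `*` `[0%R, 2%R]) < +oo)%E.
Proof.
rewrite muE.
pose c := 2 * spread + (`|b0.1| + `|b0.2|).
have c0 : 0 <= c by rewrite /c !addr_ge0 // mulr_ge0 // spread_ge0.
apply: (@le_lt_trans _ _ (area (`[- c, c] `*` `[- c, c]))); last first.
  by rewrite area_box ?ltry //; lra.
apply: le_area; [apply: measurable_psi; exact: measurableX | exact: measurableX |].
move=> p [] /=; rewrite !in_itv /= => /andP[? ?] /andP[? ?].
have [] := @spreadP 2 (psi p); try by rewrite ger0_norm.
rewrite ler_norml => /andP[? ?]; rewrite ler_norml => /andP[? ?].
have := ler_norm b0.1; have := ler_norm b0.2; have := ler_norm (- b0.1); have := ler_norm (- b0.2).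
rewrite !normrN /c => *; have ? := normr_ge0 b0.1; have ? := normr_ge0 b0.2.
by rewrite -[p]psiK /phi /=; split; apply/andP; split; lra.
Qed.

(** The margin [4 * spread] is spent in two halves. A translate meeting the disk of radius
    [r - 2 * spread] stays in the disk of radius [r], hence is listed in [s]. A point within sup
    distance 1, in profile coordinates, of a point of the smallest disk lies in the middle one, so
    listed translates cover it, as [exists_corner] requires. *)
Lemma covering_bound (X : set (plane R)) (r m : R) (s : seq (plane R)) :
  \bigcup_(x in X) translate K x = setT -> 4 * spread <= r -> uniq s ->
  (forall x, X x -> translate K x `<=` euclidean_disk r -> x \in s) ->
  (forall a b, 0 <= a <= 1 -> 0 <= b <= 1 -> hull_area mu f [:: a; b] <= m) ->
  (area (euclidean_disk (r - 4 * spread)) <= ((size s)%:R * m)%:E)%E.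
Proof.
move=> covX r4 us sP hm.
have sp0 := spread_ge0.
pose S : seq (R * R) := map B s.
have mphi : measurable_fun [set: mplane R] (phi : mplane R -> mplane R).
  have := measurable_affine_map 0 b0 (linearP A).
  by apply: eq_measurable_fun => p _; rewrite subr0.
pose E : set (mplane R) := phi @^-1` euclidean_disk (r - 4 * spread).
have mE : measurable E.
  by rewrite -[X in measurable X]setTI; apply: mphi => //; exact: measurable_disk.
have coverP (y q : R * R) : covers f y q <-> subgraph f (q - y).
  rewrite /covers /below /over /height /subgraph /=; split.
    by move=> /andP[/andP[/andP[? ?] ?] ?]; split; apply/andP; split; lra.
  by move=> [/andP[? ?] /andP[? ?]]; apply/andP; split; [apply/andP; split; [apply/andP; split|]|]; lra.
have KE x p : translate K x p <-> subgraph f (psi p - B x).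
  by rewrite translateP /K image_psi /= psiB.
have local x p (rho : R) : 0 <= rho -> euclidean_disk rho p -> translate K x p ->
    translate K x `<=` euclidean_disk (rho + 2 * spread).
  move=> rho0 dp /KE Kp p' /KE Kp'.
  have -> : p' = p + A (psi p' - psi p).
    have Epp : psi p + (psi p' - psi p) = psi p' by rewrite addrC subrK.
    by rewrite -{1}(psiK p) -phiD Epp psiK.
  have [] := @spreadP 1 (psi p' - psi p).
  - have [/andP[+ +] _] := Kp; have [/andP[+ +] _] := Kp'; rewrite /= => *.
    by rewrite ler_norml; apply/andP; split; lra.
  - have [] := subgraph_box hf Kp; have [] := subgraph_box hf Kp'.
    rewrite /= !in_itv /= => _ /andP[? ?] _ /andP[? ?].
    by rewrite ler_norml; apply/andP; split; lra.
  by rewrite mul1r => ? ?; exact: disk_shift.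
have inS x p : X x -> euclidean_disk (r - 2 * spread) p -> translate K x p -> x \in s.
  move=> Xx dp Kp; apply: sP => //.
  by have := local x p (r - 2 * spread) _ dp Kp; rewrite subrK; apply; lra.
have -> : area (euclidean_disk (r - 4 * spread)) = mu E.
  by rewrite muE; congr area; apply/seteqP; split=> p; rewrite /E /= psiK.
have <- : size S = size s by rewrite size_map.
apply: (staircase_bound mu_translate mu_box hf hm) => //.
  by rewrite map_inj_uniq //; exact: (can_inj BK).
move=> q Eq.
have covered (p : plane R) : euclidean_disk (r - 2 * spread) (phi p) ->
    exists2 w, w \in S & covers f w p.
  move=> dp; have [x Xx Kx] : (\bigcup_(x in X) translate K x) (phi p) by rewrite covX.
  exists (B x); first by apply: map_f; exact: inS Kx.
  by apply/coverP; move: Kx => /KE; rewrite phiK.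
have near (p : plane R) : `|p.1 - q.1| <= 1 -> `|p.2 - q.2| <= 1 ->
    euclidean_disk (r - 2 * spread) (phi p).
  move=> p1 p2; have -> : p = q + (p - q) by rewrite addrC subrK.
  rewrite phiD; have -> : r - 2 * spread = r - 4 * spread + 2 * spread by ring.
  have [] := @spreadP 1 (p - q) p1 p2.
  by rewrite mul1r => ? ?; apply: disk_shift => //; lra.
have [w wS wq] : exists2 w, w \in S & covers f w q.
  by apply: covered; apply: near; rewrite subrr normr0.
have [y own cy] := owner_exists wS wq.
have [yS _ _] := own.
exists y => //.
have [/andP[/andP[yq1 yq1'] yq2] qh] := andP cy.
have q2y : q.2 <= y.2 + 1.
  apply: (le_trans qh); rewrite /height lerD2l.
  by apply: (profile_le1 hf); lra.
have [|u uw [qu1 qu2]] := exists_corner hf own cy.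
  move=> p /andP[? ?] /andP[? ?]; apply: covered; apply: near; rewrite ler_norml; apply/andP; split; lra.
apply/translateP; exists u => //.
by split; rewrite /= in_itv /=; apply/andP; split; lra.
Qed.


(** * Densities as counts of translates *)

Hypothesis K_int : K° !=set0.

Let areaK : R := fine (area K).

Lemma area_KE : area K = areaK%:E.
Proof.
rewrite /areaK fineK // /K image_psi -muE.
apply: (mu_subgraph_fin mu_box hf) => //; exact: measurable_subgraph.
Qed.

Lemma area_K_gt0 : 0 < areaK.
Proof. by rewrite -lte_fin -area_KE; apply: area_interior_gt0 => //; exact: measurable_K. Qed.

Lemma sum_translates (s : seq (plane R)) : uniq s ->
  (\sum_(x \in [set` s]) area (translate K x))%E = ((size s)%:R * areaK)%:E.
Proof.
move=> us; rewrite -fsbig_seq // (eq_bigr (fun=> areaK%:E)); last first.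
  by move=> x _; rewrite area_translate ?area_KE //; exact: measurable_K.
by rewrite sumEFin big_const_seq count_predT iter_addr_0 mulr_natl.
Qed.

Let inner (X : set (plane R)) (r : R) (x : plane R) : Prop :=
  X x /\ translate K x `<=` euclidean_disk r.

Lemma disk_areaE (r : R) : 0 < r -> exists2 D : R, 0 < D & area (euclidean_disk r) = D%:E.
Proof.
move=> r0; have D0 := area_disk_gt0 r0; have := area_disk_fin r.
case: (area (euclidean_disk r)) D0 => [D|//|//] D0 _.
by exists D; rewrite // -lte_fin.
Qed.

(** The sum is a supremum over finite subfamilies, and all translates have the same area, so a bound
    on the density is a bound on cardinalities. *)
Lemma density_in_le (X : set (plane R)) (r c : R) : 0 < r ->
  (forall s, uniq s -> {in s, forall x, inner X r x} ->
    (((size s)%:R * areaK)%:E <= c%:E * area (euclidean_disk r))%E) ->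
  (lower_density_in X (translate K) (euclidean_disk r) <= c%:E)%E.
Proof.
move=> r0 bound; have [D D0 DE] := disk_areaE r0.
rewrite /lower_density_in DE inver gt_eqF // lee_pdivrMr //.
apply: ge_ereal_sup => _ [F [finF FX] <-].
have [s [us Fs]] : exists s : seq (plane R), uniq s /\ F = [set` s].
  have [s ->] := (finite_seqP F).1 finF.
  by exists (undup s); rewrite undup_uniq; split => //; apply/seteqP; split => x /=; rewrite mem_undup.
rewrite Fs sum_translates // -DE; apply: bound => // x xs.
by apply: FX; rewrite Fs.
Qed.

Lemma density_in_ge (X : set (plane R)) (r c : R) : 0 < r ->
  (exists s, [/\ uniq s, {in s, forall x, inner X r x} &
    (c%:E * area (euclidean_disk r) <= ((size s)%:R * areaK)%:E)%E]) ->
  (c%:E <= lower_density_in X (translate K) (euclidean_disk r))%E.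
Proof.
move=> r0 [s [us sX le]]; have [D D0 DE] := disk_areaE r0.
rewrite /lower_density_in DE inver gt_eqF // lee_pdivlMr // -DE.
apply: esum_ge; exists [set` s]; first by split; [exact: finite_seq | move=> x; exact: sX].
by rewrite sum_translates.
Qed.

Lemma lower_density_le (X : set (plane R)) (c : \bar R) :
  (forall r, 0 < r -> (lower_density_in X (translate K) (euclidean_disk r) <= c)%E) ->
  (lower_density X (translate K) <= c)%E.
Proof.
move=> le; rewrite /lower_density limf_einfE; apply: ge_ereal_sup => _ [V [M [_ VM]] <-].
apply: ge_ereal_inf.
(* The radius has to be positive as well as beyond [M]. *)
exists (lower_density_in X (translate K) (euclidean_disk (`|M| + 1))); last first.
  by apply: le; apply: ltr_wpDl.
exists (`|M| + 1) => //; apply: VM.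
by apply: (le_lt_trans (ler_norm M)); rewrite ltrDl.
Qed.

Lemma lower_density_ge (X : set (plane R)) (c : \bar R) (M : R) :
  (forall r, M < r -> (c <= lower_density_in X (translate K) (euclidean_disk r))%E) ->
  (c <= lower_density X (translate K))%E.
Proof.
move=> le; rewrite /lower_density limf_einfE; apply: le_ereal_sup_tmp.
exists (ereal_inf [set lower_density_in X (translate K) (euclidean_disk r) | r in [set r | M < r]]).
  by exists [set r | M < r] => //; exists M; rewrite num_real.
by apply: le_ereal_inf_tmp => _ [r Mr <-]; exact: le.
Qed.

(** The tiles [ltile f a b] cover the plane along a lattice and lie in the corresponding translates
    of [K], so these cover too. The translates inside a disk carry disjoint tiles of measure at
    least [w], which bounds their number. *)
Lemma lattice_bound (a b : R) : 0 <= a -> a <= b -> b <= 1 ->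
  0 < hull_area mu f [:: a; b] ->
  (theta_L K <= (areaK / hull_area mu f [:: a; b])%:E)%E.
Proof.
move=> a0 ab b1 w0.
set w := hull_area mu f [:: a; b].
have a01 : 0 <= a <= 1 by apply/andP; split; lra.
have b01 : 0 <= b <= 1 by apply/andP; split; lra.
have ab01 : {in [:: a; b], forall s, 0 <= s <= 1}.
  by move=> s; rewrite !inE => /orP[] /eqP ->.
have fb0 : 0 <= f b by apply: (profile_ge0 hf); lra.
have fab : f b <= f a by apply: (profile_mono hf).
have wt : (w%:E <= mu (ltile f a b))%E.
  rewrite -(hull_areaE mu_box hf ab01).
  exact: (mu_hull2_ltile mu_translate mu_box hf).
(* Lattice determinant up to sign. It is positive because a tile of positive measure contains a
   point. *)
pose D := b * f b + a * (f a - f b).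
have D0 : 0 < D.
  have [[x y]] : ltile f a b !=set0.
    apply/set0P/negP => /eqP E; by move: wt; rewrite E measure0 lee_fin leNgt w0.
  move=> /(ltileP _ _ ab fab)[x0 y0 xb ya [xa|yb]].
    have : 0 < a * f a by apply: mulr_gt0; lra.
    have : 0 <= (b - a) * f b by apply: mulr_ge0; lra.
    by rewrite /D; lra.
  have : 0 < b * f b by apply: mulr_gt0; lra.
  have : 0 <= a * (f a - f b) by apply: mulr_ge0; lra.
  by rewrite /D; lra.
pose v1 : plane R := (a, f b); pose v2 : plane R := (b, f b - f a).
pose X : set (plane R) := [set A v1 *~ m + A v2 *~ n | m in [set: int] & n in [set: int]].
have lvecE (m n : int) : A v1 *~ m + A v2 *~ n = A (lvec f a b m%:~R n%:~R).
  rewrite -!raddfMz -raddfD; congr (A _).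
  by rewrite !intmul_pair /lvec; congr (_, _) => /=; rewrite ![_%:~R * _]mulrC.
have XE x : X x <-> exists m n : int, x = A (lvec f a b m%:~R n%:~R).
  split; first by move=> [m _ [n _ <-]]; exists m, n.
  by move=> [m [n ->]]; exists m => //; exists n.
(* Cramer's rule for the lattice coordinates. *)
have coefE (s t : R) :
    s * D = (f a - f b) * (lvec f a b s t).1 + b * (lvec f a b s t).2 /\
    t * D = f b * (lvec f a b s t).1 - a * (lvec f a b s t).2.
  by rewrite /lvec /D /=; split; ring.
have latX : is_lattice X.
  exists (A v1), (A v2); split => // s t.
  rewrite -!linearZ -linearD -[X in _ = X](linear0 A) => /(can_inj AK) E.
  have {}E : lvec f a b s t = 0 by [].
  have [] := coefE s t; rewrite E /= !mulr0 ?subr0 addr0 => /eqP Es /eqP Et.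
  by split; apply/eqP; [move: Es | move: Et]; rewrite mulf_eq0 [X in _ || X]gt_eqF // orbF.
have lvecB (m n m' n' : int) : lvec f a b m%:~R n%:~R - lvec f a b m'%:~R n'%:~R =
    lvec f a b (m - m')%:~R (n - n')%:~R.
  by rewrite /lvec !intrB; congr (_, _) => /=; ring.
(* Composed with [B], the forms of [coefE] return [D] times the integer coordinates of a difference,
   and an integer multiple of [D] smaller than [D] in absolute value vanishes. *)
have discX : discrete_set X.
  pose e1 := B (1, 0); pose e2 := B (0, 1).
  apply: (@discrete_of_forms R X ((f a - f b) * e1.1 + b * e1.2) ((f a - f b) * e2.1 + b * e2.2)
    (f b * e1.1 - a * e1.2) (f b * e2.1 - a * e2.2) D D0).
  move=> x y /XE[m [n ->]] /XE[m' [n' ->]].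
  rewrite -linearB lvecB; set z := lvec _ _ _ _ _.
  have Bz := plane_linearE (A z) linB; rewrite AK in Bz.
  have [Bz1 Bz2] := (congr1 fst Bz, congr1 snd Bz).
  have [cm cn] := coefE (m' - m)%:~R (n' - n)%:~R.
  have -> : ((f a - f b) * e1.1 + b * e1.2) * (A z).1 + ((f a - f b) * e2.1 + b * e2.2) * (A z).2 =
      (m' - m)%:~R * D by rewrite cm -/z Bz1 Bz2 /= /e1 /e2; ring.
  have -> : (f b * e1.1 - a * e1.2) * (A z).1 + (f b * e2.1 - a * e2.2) * (A z).2 =
      (n' - n)%:~R * D by rewrite cn -/z Bz1 Bz2 /= /e1 /e2; ring.
  have small (k : int) : `|k%:~R * D| < D -> k = 0.
    rewrite normrM (gtr0_norm D0) -[X in _ < X]mul1r ltr_pM2r // ltr_norml.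
    by case/andP; case: (int_cases R k) => [k1|//|k1] k2 k3; exfalso; lra.
  by move=> /small/subr0_eq -> /small/subr0_eq ->.
have coverX : \bigcup_(x in X) translate K x = setT.
  apply/seteqP; split => // p _.
  have [m [n mn]] := ltile_cover (psi p) a0 ab fb0 fab D0.
  exists (A (lvec f a b m%:~R n%:~R)); first by apply/XE; exists m, n.
  rewrite /K image_psi translate_psi AK; apply/translateP.
  exact: (ltile_subgraph hf a01 b01).
apply: (@le_trans _ _ (lower_density X (translate K))).
  by apply: ge_ereal_inf; exists (lower_density X (translate K)) => //; exists X.
apply: lower_density_le => r r0; apply: density_in_le => // s us sX.
rewrite -/w.
pose T : set (mplane R) := psi @^-1` ltile f a b.
have mT : measurable T by apply: measurable_psi; exact: measurable_ltile.
have pack : (\sum_(x <- s) area T <= area (euclidean_disk r))%E.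
  apply: (@packing_bound R (@area_measure R)) => //.
  - by move=> S v mS; exact: area_translate.
  - exact: measurable_disk.
  - move=> x y xs ys xy; apply/seteqP; split => // p.
    rewrite /T !translate_psi => -[/= /translateP px /translateP py].
    have [/XE[m [n xE]] _] := sX _ xs; have [/XE[m' [n' yE]] _] := sX _ ys.
    move: px py; rewrite xE yE !AK => px py.
    have [] := @ltile_disjoint _ f a b _ _ (m' - m) (n' - n) a0 ab fb0 fab px py.
      by rewrite -lvecB addrA subrK.
    by move=> /subr0_eq mm /subr0_eq nn; move/eqP: xy; apply; rewrite xE yE mm nn.
  - move=> x xs; have [_ sub] := sX _ xs; apply: subset_trans sub.
    rewrite /T /K image_psi !translate_psi => p /= /translateP px; apply/translateP.
    exact: (ltile_subgraph hf a01 b01).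
have [d d0 dE] := disk_areaE r0; move: pack; rewrite dE -muE => pack.
have : (((size s)%:R * w)%:E <= d%:E)%E.
  apply: le_trans pack; apply: (@le_trans _ _ (\sum_(x <- s) w%:E)%E); last exact: lee_sum.
  by rewrite sumEFin big_const_seq count_predT iter_addr_0 mulr_natl.
rewrite !lee_fin => sw; rewrite mulrAC ler_pdivlMr // [areaK * d]mulrC mulrAC.
by apply: ler_wpM2r => //; rewrite ltW // area_K_gt0.
Qed.

(** [lattice_bound] read backwards: it provides the hypothesis of [covering_bound] with
    [m = areaK / t]. *)
Lemma theta_L_hull2 (t a b : R) : 0 < t -> (t%:E <= theta_L K)%E ->
  0 <= a <= 1 -> 0 <= b <= 1 -> hull_area mu f [:: a; b] <= areaK / t.
Proof.
move=> t0 tL; wlog ab : a b / a <= b => [H a01 b01|a01 b01].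
  have [ab|/ltW ba] := leP a b; first exact: H.
  by rewrite (hull_area_perm mu f (_ : perm_eq _ [:: b; a])) ?H // (perm_catC [:: a] [:: b]).
have [w0|w0] := leP (hull_area mu f [:: a; b]) 0.
  by apply: (le_trans w0); rewrite divr_ge0 // ltW // area_K_gt0.
have [[? ?] [? ?]] := (andP a01, andP b01).
have := le_trans tL (@lattice_bound a b _ ab _ w0).
rewrite lee_fin ler_pdivlMr // mulrC => H.
by rewrite ler_pdivlMr //; apply: H.
Qed.

Lemma theta_L_le_density (X : set (plane R)) : \bigcup_(x in X) translate K x = setT ->
  (theta_L K <= lower_density X (translate K))%E.
Proof.
move=> covX.
have k0 := area_K_gt0; have sp0 := spread_ge0.
(* Real numbers [t' < t] leave room for the boundary layer of the disk and also settle the case of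
   an infinite [theta_L K]. *)
suff key (t t' : R) : t' < t -> (t%:E <= theta_L K)%E -> (t'%:E <= lower_density X (translate K))%E.
  rewrite leNgt; apply/negP.
  have : (0%:E <= lower_density X (translate K))%E.
    apply: (@lower_density_ge _ _ 0) => r r0; apply: density_in_ge => //.
    by exists [::]; split => //; rewrite mul0e mul0r.
  case: (lower_density X (translate K)) key => [l||//] key _; last by rewrite ltNge leey.
  case: (theta_L K) key => [u||//] key; rewrite ?lte_fin => lu.
    have := key ((l + u) / 2 + (u - l) / 4) ((l + u) / 2); rewrite !lee_fin.
    by move=> /(_ ltac:(lra) ltac:(lra)); lra.
  have := key (l + 2) (l + 1) ltac:(lra) (leey _); rewrite lee_fin; lra.
move=> tt' tL.
have ge0 r : 0 < r -> (0%:E <= lower_density_in X (translate K) (euclidean_disk r))%E.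
  move=> r0; apply: density_in_ge => //; exists [::]; split => //.
  by rewrite mul0e mul0r.
have [t0|t0] := leP t 0.
  by apply: (@lower_density_ge _ _ 0) => r /ge0; apply: le_trans; rewrite lee_fin; lra.
(* Beyond this radius [t * (r - 4 * spread) ^+ 2] is at least [t' * r ^+ 2]: the loss at the
   boundary is absorbed by the gap between [t'] and [t]. *)
apply: (@lower_density_ge _ _ (4 * spread + 8 * spread * t / (t - t'))) => r rM.
have [r4 rt] : 4 * spread < r /\ 8 * spread * t < r * (t - t').
  have q0 : 0 <= 8 * spread * t / (t - t') by rewrite divr_ge0 ?mulr_ge0 //; lra.
  split; first lra.
  by rewrite -ltr_pdivrMr ?subr_gt0 //; lra.
have r0 : 0 < r by lra.
apply: density_in_ge => //.
have [D D0 DE] := disk_areaE r0.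
have [fin|inf] := pselect (finite_set (inner X r)).
  have [s [us sE]] : exists s : seq (plane R), uniq s /\ inner X r = [set` s].
    have [s ->] := (finite_seqP _).1 fin.
    by exists (undup s); rewrite undup_uniq; split => //; apply/seteqP; split => x /=; rewrite mem_undup.
  exists s; split => //; first by move=> x xs; rewrite sE.
  have sP x : X x -> translate K x `<=` euclidean_disk r -> x \in s.
    by move=> Xx sub; have : inner X r x by []; rewrite sE.
  have := covering_bound covX (ltW r4) us sP (fun a b => @theta_L_hull2 t a b t0 tL).
  have [d d0 dE] := disk_areaE (@ltr01 R).
  rewrite (area_disk_scale r0) area_disk_scale; last lra.
  rewrite dE -!EFinM !lee_fin mulrA ler_pdivlMr //; apply: le_trans.
  rewrite mulrA [leRHS]mulrAC; apply: ler_wpM2r; first exact: ltW.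
  have : r * (8 * spread * t) <= r * (r * (t - t')) by rewrite ler_pM2l // ltW.
  have : 0 <= t * spread ^+ 2 by rewrite mulr_ge0 ?sqr_ge0 // ltW.
  rewrite !expr2; lra.
(* With infinitely many translates inside the disk, a finite subfamily can be taken large enough to
   exceed any given density. *)
have [F FX Fn] := infinite_set_fset (Num.bound `|t' * D / areaK|) inf.
exists (finmap.enum_fset F); split; first exact: finmap.fset_uniq.
  by move=> x xF; apply: FX.
rewrite DE -EFinM lee_fin -ler_pdivrMr //.
apply: (le_trans (ler_norm _)); apply: (le_trans (ltW (archi_boundP (normr_ge0 _)))).
by rewrite ler_nat.
Qed.

End Pullback.

Theorem theorem1p2 (R : realType) (K : set (plane R))
  (hK : quarter_convex_disk K) : theta_T K = theta_L K.
Proof.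
case: hK => -[_ _ K_int] [f [hf [A [b [[B AK BK] KE]]]]].
apply/le_anti/andP; split.
  (* Lattice coverings are among the translative ones; the converse inequality is proved for each
     translative covering separately. *)
  by apply: ereal_inf_le_tmp => _ [X [covX _] <-]; exists X.
apply: le_ereal_inf_tmp => _ [X [_ covX] <-].
have [mu muE] := exists_pullback_measure b AK BK.
rewrite KE in K_int covX *.
exact: (theta_L_le_density hf AK BK muE K_int covX).
Qed.
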